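(* Consider ${\rm APP}=\{{\rm APP}_{\infty,d}\}_{d\in\mathbb N}$ in the worst case setting for the absolute or normalized error criterion $\star\in\{{\rm ABS},{\rm NOR}\}$. Then ALG-PT for $\Lambda^{\rm all}$ is equivalent to ALG-PT for $\Lambda^{\rm std}$; and ALG-SPT for $\Lambda^{\rm all}$ is equivalent to ALG-SPT for $\Lambda^{\rm std}$, in which case ${\rm ALG}\text{-}p^\star(\Lambda^{\rm all})={\rm ALG}\text{-}p^\star(\Lambda^{\rm std})$.
   Context: $\mathbb T^d=[0,1]^d$ is the torus with Lebesgue measure; $\hat f(\mathbf k)=\int f(\mathbf x)e^{-2\pi i\mathbf k\cdot\mathbf x}d\mathbf x$. For each $d$ let $\omega_d:\mathbb Z^d\to(0,\infty)$ with $\sum_{\mathbf k}\omega_d(\mathbf k)^{-2}<\infty$, and $H^{\omega_d}(\mathbb T^d)$ the Hilbert space of $f\in L_2(\mathbb T^d)$ with $\|f\|^2=\sum_{\mathbf k}|\hat f(\mathbf k)|^2\omega_d(\mathbf k)^2<\infty$. ${\rm APP}_{\infty,d}:H^{\omega_d}(\mathbb T^d)\to L_\infty(\mathbb T^d)$ (sup norm), $f\mapsto f$. $\Lambda^{\rm all}$: all continuous linear functionals; $\Lambda^{\rm std}$: point evaluations. $e(n,{\rm APP}_{\infty,d};\Lambda)$: infimum over algorithms $A(f)=\phi(L_1f,\dots,L_nf)$, $L_i\in\Lambda$, $\phi$ arbitrary, of $\sup_{\|f\|\le1}\|f-A(f)\|_\infty$; $e(0,{\rm APP}_{\infty,d})=\sup_{\|f\|\le1}\|f\|_\infty$.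 $n^\star(\varepsilon,d;\Lambda)=\inf\{n\ge0:e(n,{\rm APP}_{\infty,d};\Lambda)\le\varepsilon{\rm CRI}_d\}$ with ${\rm CRI}_d=1$ (ABS) or $e(0,{\rm APP}_{\infty,d})$ (NOR). ALG-PT for $\Lambda$: there exist $C>0$, $p,q\ge0$ with $n^\star(\varepsilon,d;\Lambda)\le Cd^q\varepsilon^{-p}$ for all $d\in\mathbb N,\varepsilon\in(0,1)$. ALG-SPT: the same with $q=0$; ${\rm ALG}\text{-}p^\star(\Lambda)$ is the infimum of such $p$. *)

(* Defs.v *)
From Stdlib Require Import Reals List ZArith ClassicalEpsilon.
From Coquelicot Require Import Coquelicot.
Open Scope R_scope.

(* Frequencies k in Z^d are encoded as k : nat -> Z with k i = 0 for i >= d. *)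
Definition Zvec := nat -> Z.
Definition supp (d : nat) (k : Zvec) : Prop := forall i, (d <= i)%nat -> k i = 0%Z.

Definition fin_index (d : nat) (l : list Zvec) : Prop := NoDup l /\ List.Forall (supp d) l.

Definition rsum {A : Type} (l : list A) (a : A -> R) : R :=
  fold_right (fun k s => a k + s) 0 l.
Definition csum {A : Type} (l : list A) (a : A -> C) : C :=
  fold_right (fun k s => Cplus (a k) s) (RtoC 0) l.

(* points x in T^d = [0,1]^d are encoded as x : nat -> R (coordinates >= d are ignored) *)
Definition in_cube (d : nat) (x : nat -> R) : Prop := forall i, (i < d)%nat -> 0 <= x i <= 1.
Definition dot (d : nat) (k : Zvec) (x : nat -> R) : R :=
  rsum (seq 0 d) (fun i => IZR (k i) * x i).
Definition cis2pi (t : R) : C := (cos (2 * PI * t), sin (2 * PI * t)).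

Definition Weight := nat -> Zvec -> R.
Definition weight_ok (w : Weight) : Prop :=
  forall d, (forall k, supp d k -> 0 < w d k) /\
    exists M, forall l, fin_index d l -> rsum l (fun k => / (w d k) ^ 2) <= M.

(* elements f of H^{omega_d} are represented by their Fourier coefficients c = \hat f *)
Definition Coef := Zvec -> C.
Definition wsum (d : nat) (w : Weight) (c : Coef) (l : list Zvec) : R :=
  rsum l (fun k => (Cmod (c k)) ^ 2 * (w d k) ^ 2).
Definition inH (d : nat) (w : Weight) (c : Coef) : Prop :=
  (forall k, ~ supp d k -> c k = RtoC 0) /\
  exists M, forall l, fin_index d l -> wsum d w c l <= M.
Definition unit_ball (d : nat) (w : Weight) (c : Coef) : Prop :=
  forall l, fin_index d l -> wsum d w c l <= 1.

Definition has_sum (d : nat) (a : Zvec -> C) (v : C) : Prop :=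
  forall eps, 0 < eps -> exists l0, fin_index d l0 /\
    forall l, fin_index d l -> incl l0 l -> Cmod (Cminus (csum l a) v) < eps.

Definition fval (d : nat) (c : Coef) (x : nat -> R) : C :=
  epsilon (inhabits (RtoC 0))
    (fun v => has_sum d (fun k => Cmult (c k) (cis2pi (dot d k x))) v).

Definition Functional := Coef -> C.
Definition InfoClass := nat -> Weight -> Functional -> Prop.

Definition lam_all : InfoClass := fun d w L =>
  (forall f g a, inH d w f -> inH d w g ->
     L (fun k => Cplus (Cmult a (f k)) (g k)) = Cplus (Cmult a (L f)) (L g)) /\
  exists K, forall f, inH d w f -> unit_ball d w f -> Cmod (L f) <= K.

Definition lam_std : InfoClass := fun d w L =>
  exists x, in_cube d x /\
    forall f, inH d w f -> has_sum d (fun k => Cmult (f k) (cis2pi (dot d k x))) (L f).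

Definition Output := (nat -> R) -> C.

Definition alg_error (d : nat) (w : Weight) (n : nat) (Ls : nat -> Functional)
  (phi : list C -> Output) : Rbar :=
  Lub_Rbar (fun r => exists f x, inH d w f /\ unit_ball d w f /\ in_cube d x /\
     r = Cmod (Cminus (fval d f x) (phi (map (fun i => Ls i f) (seq 0 n)) x))).

Definition e_n (Lam : InfoClass) (d : nat) (w : Weight) (n : nat) : Rbar :=
  Glb_Rbar (fun r => exists Ls phi, (forall i, (i < n)%nat -> Lam d w (Ls i)) /\
     alg_error d w n Ls phi = Finite r).

Definition init_error (d : nat) (w : Weight) : Rbar :=
  Lub_Rbar (fun r => exists f x, inH d w f /\ unit_ball d w f /\ in_cube d x /\
     r = Cmod (fval d f x)).

Inductive criterion := ABS | NOR.
Definition CRI (crit : criterion) (d : nat) (w : Weight) : Rbar :=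
  match crit with ABS => Finite 1 | NOR => init_error d w end.

Definition nstar (Lam : InfoClass) (crit : criterion) (w : Weight) (eps : R) (d : nat) : Rbar :=
  Glb_Rbar (fun r => exists n : nat, r = INR n /\
     Rbar_le (e_n Lam d w n) (Rbar_mult (Finite eps) (CRI crit d w))).

Definition ALG_PT (Lam : InfoClass) (crit : criterion) (w : Weight) : Prop :=
  exists C0 p q, 0 < C0 /\ 0 <= p /\ 0 <= q /\
    forall d eps, (1 <= d)%nat -> 0 < eps < 1 ->
      Rbar_le (nstar Lam crit w eps d) (Finite (C0 * Rpower (INR d) q * Rpower eps (- p))).

Definition ALG_SPT_with (Lam : InfoClass) (crit : criterion) (w : Weight) (p : R) : Prop :=
  exists C0, 0 < C0 /\
    forall d eps, (1 <= d)%nat -> 0 < eps < 1 ->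
      Rbar_le (nstar Lam crit w eps d) (Finite (C0 * Rpower eps (- p))).

Definition ALG_SPT (Lam : InfoClass) (crit : criterion) (w : Weight) : Prop :=
  exists p, 0 <= p /\ ALG_SPT_with Lam crit w p.

Definition ALG_pstar (Lam : InfoClass) (crit : criterion) (w : Weight) : Rbar :=
  Glb_Rbar (fun p => 0 <= p /\ ALG_SPT_with Lam crit w p).

(* Main.v *)
Require Import Defs.
From Stdlib Require Import Reals.
From Coquelicot Require Import Coquelicot.
From Stdlib Require Import List ZArith Lra Lia Permutation.
From Stdlib Require Import Classical ClassicalEpsilon FunctionalExtensionality.
From mathcomp Require all_boot all_order all_algebra all_fingroup complex Rstruct ring.

(** Write [lambda_k = omega_d(k)^-2] and let [T^2] be the sum of all [lambda_k]
    except the [n] largest.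

    Lower bound for arbitrary linear information: if [P] is the orthogonal
    projection onto the common kernel of [n] functionals, then averaging
    [sup { |f(x)|^2 : ||f|| <= 1, L_i f = 0 }] over [x] gives
    [sum_k lambda_k P_kk], where [0 <= P_kk <= 1] and the [1 - P_kk] sum to at
    most [n]; so the error is at least [T].

    Upper bound for function values: let [D_N] be the maximum over [N] points of
    the determinant of the kernel matrix [(K(x_i, x_j))].  At a maximizing point
    set the squared power function, hence the squared error of interpolation, is
    at most [D_{N+1} / D_N].  With [P_N] the sum of [prod_i lambda_{S_i}] over
    injective [N]-tuples [S], Cauchy-Binet and orthogonality of the characters
    give [P_N <= D_N], Cauchy-Binet and Hadamard give
    [D_N <= (N^N / N!) P_N <= 4^N P_N], and
    [P_{2n} <= binom(2n, n) T^{2n} P_n].  Hence [D_{2n} <= (64 T^2)^n D_n], and some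
    [N] in [[n, 2n)] satisfies [D_{N+1} <= 64 T^2 D_N].

    So at most [2n] samples are as good, up to a constant factor, as [n]
    arbitrary functionals, and all exponents are preserved.  Truncating to
    finitely many frequencies and restricting points to a fine product grid turns
    both bounds into finite-dimensional statements. *)

Module FiniteDimension.

Import all_boot all_order all_algebra all_fingroup complex Rstruct ring.
Set Implicit Arguments.
Unset Strict Implicit.
Unset Printing Implicit Defensive.
Import Order.TTheory GRing.Theory Num.Theory.
Delimit Scope R_scope with coqR.
Delimit Scope Z_scope with coqZ.
Local Open Scope ring_scope.

(** * Gram determinants *)

Section Gram.
Variable C : numClosedFieldType.

Definition adj m n (A : 'M[C]_(m, n)) : 'M[C]_(n, m) := map_mx Num.conj A^T.
Definition gram m n (A : 'M[C]_(m, n)) : 'M[C]_m := A *m adj A.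
(** The squared Euclidean norm, so that it factors out of Gram determinants without roots. *)
Definition rownorm n (v : 'rV[C]_n) : C := \sum_k `|v 0 k| ^+ 2.

Lemma adjM m n p (A : 'M[C]_(m, n)) (B : 'M_(n, p)) : adj (A *m B) = adj B *m adj A.
Proof. by rewrite /adj trmx_mul map_mxM. Qed.

Lemma adjK m n (A : 'M[C]_(m, n)) : adj (adj A) = A.
Proof. by apply/matrixP=> i j; rewrite !mxE conjCK. Qed.

Lemma det_adj n (A : 'M[C]_n) : \det (adj A) = (\det A)^*.
Proof. by rewrite /adj det_map_mx det_tr. Qed.

Lemma rownormE n (v : 'rV[C]_n) : (v *m adj v) 0 0 = rownorm v.
Proof. by rewrite mxE; apply: eq_bigr => k _; rewrite !mxE normCK. Qed.

Lemma rownorm_ge0 n (v : 'rV[C]_n) : 0 <= rownorm v.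
Proof. by apply: sumr_ge0 => k _; rewrite exprn_ge0. Qed.

Lemma rownorm_eq0 n (v : 'rV[C]_n) : rownorm v = 0 -> v = 0.
Proof.
move/eqP; rewrite psumr_eq0 => [/allP h|k _]; last by rewrite exprn_ge0.
apply/rowP=> k; rewrite mxE; apply/eqP.
by have := h k (mem_index_enum _); rewrite /= sqrf_eq0 normr_eq0.
Qed.

(** Expanding the nonnegative sum of [|B a_i - s b_i|^2] gives [B (B A - |s|^2)]; the case [B = 0]
    forces every [b_i] to vanish. *)
Lemma cauchy_schwarz (I : finType) (a b : I -> C) :
  `|\sum_i a i * (b i)^*| ^+ 2 <= (\sum_i `|a i| ^+ 2) * (\sum_i `|b i| ^+ 2).
Proof.
set s := \sum_i a i * _; set B := \sum_i `|b i| ^+ 2; set A := \sum_i `|a i| ^+ 2.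
have B0 : 0 <= B by apply: sumr_ge0 => i _; rewrite exprn_ge0.
have [BE|Bn0] := eqVneq B 0.
  have b0 i : b i = 0.
    move/eqP: BE; rewrite psumr_eq0 => [/allP h|k _]; last by rewrite exprn_ge0.
    by apply/eqP; have := h i (mem_index_enum _); rewrite /= sqrf_eq0 normr_eq0.
  by rewrite /s big1 ?BE ?normr0 ?mulr0 ?expr0n // => i _; rewrite b0 conjC0 mulr0.
have Bgt : 0 < B by rewrite lt_def Bn0.
have Bc : B^* = B by apply: CrealP; apply: ger0_real.
have : 0 <= \sum_i `|B * a i - s * b i| ^+ 2 by apply: sumr_ge0 => i _; rewrite exprn_ge0.
have -> : \sum_i `|B * a i - s * b i| ^+ 2 = B * (B * A - `|s| ^+ 2).
  transitivity (\sum_i (B ^+ 2 * `|a i| ^+ 2 - B * s^* * (a i * (b i)^*)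
      - B * s * (a i * (b i)^*)^* + s * s^* * `|b i| ^+ 2)).
    apply: eq_bigr => i _; rewrite !normCK rmorphB !rmorphM /= conjCK Bc; ring.
  rewrite !big_split /= !sumrN -!mulr_sumr -rmorph_sum /= -/s -/A -/B normCK; ring.
by rewrite pmulr_rge0 // subr_ge0 mulrC.
Qed.

(** Column choices range over all maps rather than increasing ones, which accounts for the factor
    [N!]. Both determinants are expanded by the Leibniz formula, and summing over [S] coordinatewise
    produces the entries of [A *m adj B]. *)
Lemma cauchy_binet N g (A B : 'M[C]_(N, g)) :
  \sum_(S : {ffun 'I_N -> 'I_g}) \det (colsub S A) * (\det (colsub S B))^*
  = N`!%:R * \det (A *m adj B).
Proof.
have dE (S : {ffun 'I_N -> 'I_g}) (X : 'M[C]_(N, g)) :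
    \det (colsub S X) = \sum_(s : 'S_N) (-1) ^+ s * \prod_j X (s j) (S j).
  rewrite -det_tr; apply: eq_bigr => s _; congr (_ * _).
  by apply: eq_bigr => j _; rewrite !mxE.
transitivity (\sum_(t : 'S_N) \sum_(s : 'S_N)
    (-1) ^+ s * (-1) ^+ t * \prod_j (A *m adj B) (s j) (t j)).
  under eq_bigr do rewrite !dE rmorph_sum /= mulr_sumr.
  rewrite exchange_big /=; apply: eq_bigr => t _.
  under eq_bigr do rewrite mulr_suml.
  rewrite exchange_big /=; apply: eq_bigr => s _.
  have -> : \prod_j (A *m adj B) (s j) (t j) =
      \sum_(S : {ffun 'I_N -> 'I_g}) \prod_j (A (s j) (S j) * (B (t j) (S j))^*).
    rewrite -(bigA_distr_bigA (fun j k => A (s j) k * (B (t j) k)^*)).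
    by apply: eq_bigr => j _; rewrite mxE; apply: eq_bigr => k _; rewrite !mxE.
  rewrite mulr_sumr; apply: eq_bigr => S _.
  by rewrite rmorphM rmorph_sign /= big_split /= rmorph_prod mulrACA.
transitivity (\sum_(t : 'S_N) \det (A *m adj B)).
  apply: eq_bigr => t _; rewrite -det_tr /determinant.
  (* Replacing [s] by [t * s], and then [j] by its preimage under [t], cancels the sign of [t]:
     every [t] contributes the same determinant. *)
  rewrite (reindex_inj (mulgI t)) /=; apply: eq_bigr => s _.
  rewrite odd_permM signr_addb (reindex_inj (@perm_inj _ t^-1)) /=.
  transitivity ((-1) ^+ s * ((-1) ^+ t * (-1) ^+ t) * \prod_j (A *m adj B) (s j) j).
    congr (_ * _); first by rewrite mulrA [(-1) ^+ t * _]mulrC.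
    by apply: eq_bigr => j _; rewrite permM permKV.
  rewrite -signr_addb addbb mulr1; congr (_ * _).
  by apply: eq_bigr => j _; rewrite [RHS]mxE.
rewrite sumr_const mulr_natl; congr (_ *+ _); rewrite -card_Sn; exact: eq_card.
Qed.

Lemma sum_det_colsub N g (A : 'M[C]_(N, g)) :
  \sum_(S : {ffun 'I_N -> 'I_g}) `|\det (colsub S A)| ^+ 2 = N`!%:R * \det (gram A).
Proof. by rewrite -cauchy_binet; apply: eq_bigr => S _; rewrite normCK. Qed.

Lemma fact_gt0R N : 0 < N`!%:R :> C.
Proof. by rewrite ltr0n fact_gt0. Qed.

Lemma det_gram_ge0 N g (A : 'M[C]_(N, g)) : 0 <= \det (gram A).
Proof.
rewrite -(pmulr_rge0 _ (fact_gt0R N)) -sum_det_colsub.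
by apply: sumr_ge0 => S _; rewrite exprn_ge0.
Qed.

(** Cauchy-Schwarz applied to the vectors of all [N]-column minors of [A] and of [B]. *)
Lemma det_mixed_gram N g (A B : 'M[C]_(N, g)) :
  `|\det (A *m adj B)| ^+ 2 <= \det (gram A) * \det (gram B).
Proof.
have F0 := fact_gt0R N.
have := cauchy_schwarz (fun S : {ffun 'I_N -> 'I_g} => \det (colsub S A))
                       (fun S => \det (colsub S B)).
rewrite cauchy_binet !sum_det_colsub normrM (ger0_norm (ltW F0)) exprMn.
by rewrite [X in _ <= X -> _]mulrACA -expr2 ler_pM2l // exprn_gt0.
Qed.

(** A row vector [w] annihilated by the Gram matrix makes the squared norm of [w *m U] vanish. *)
Lemma gram_unit N g (U : 'M[C]_(N, g)) : row_free U -> gram U \in unitmx.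
Proof.
move=> fU; rewrite -row_free_unit -kermx_eq0; apply/eqP/row_matrixP => i.
rewrite row0; set w := row i _.
have w0 : w *m gram U = 0 by rewrite -row_mul mulmx_ker row0.
have wU : w *m U = 0.
  apply: rownorm_eq0; rewrite -rownormE adjM mulmxA -(mulmxA w) -/(gram U) w0.
  by rewrite mul0mx mxE.
by apply: (row_free_inj fU); rewrite wU mul0mx.
Qed.

Lemma unit_gram N g (U : 'M[C]_(N, g)) : gram U \in unitmx -> row_free U.
Proof.
move=> uG; rewrite -kermx_eq0; apply/eqP.
have : kermx U *m gram U = 0 by rewrite mulmxA mulmx_ker mul0mx.
by move/(congr1 (mulmx^~ (invmx (gram U)))); rewrite mulmxK // mul0mx.
Qed.

Section Residual.
Variables (N g : nat) (U : 'M[C]_(N, g)) (v : 'rV[C]_g).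
Hypothesis uG : gram U \in unitmx.

(** Solution of the normal equations: [coefs *m U] is the orthogonal projection of [v] onto the row
    space of [U]. *)
Definition coefs : 'rV[C]_N := v *m adj U *m invmx (gram U).
Definition resid : 'rV[C]_g := v - coefs *m U.

Lemma resid_orth : resid *m adj U = 0.
Proof. by rewrite mulmxBl -mulmxA -/(gram U) mulmxKV // subrr. Qed.

Lemma orth_resid : U *m adj resid = 0.
Proof. by rewrite -[U]adjK -adjM resid_orth /adj trmx0 map_mx0. Qed.

Lemma resid_norm : resid *m adj resid = resid *m adj v.
Proof.
have -> : adj resid = adj v - adj (coefs *m U) by rewrite /adj linearB map_mxB.
by rewrite mulmxBr adjM [in X in _ - X]mulmxA resid_orth mul0mx subr0.
Qed.

(** Subtracting from [v] its projection is a row operation of determinant one and makes the Gram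
    matrix block diagonal. The ratio of successive Gram determinants is thus a squared distance to a
    subspace. *)
Lemma det_gram_col : \det (gram (col_mx v U)) = rownorm resid * \det (gram U).
Proof.
have -> : gram (col_mx v U) =
   block_mx 1 coefs 0 1%:M *m gram (col_mx resid U) *m adj (block_mx 1 coefs 0 1%:M).
  have -> : col_mx v U = block_mx 1 coefs 0 1%:M *m col_mx resid U.
    by rewrite mul_block_col !mul1mx mul0mx add0r subrK.
  by rewrite /gram adjM !mulmxA.
have d1 : \det (block_mx 1 coefs 0 1%:M) = 1 :> C by rewrite det_ublock !det1 mulr1.
rewrite 2!det_mulmx det_adj d1 rmorph1 mul1r mulr1.
have -> : gram (col_mx resid U) = block_mx (resid *m adj resid) 0 0 (gram U).
  rewrite /gram /adj tr_col_mx map_row_mx mul_col_row -!/(adj _).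
  by rewrite resid_orth orth_resid.
by rewrite det_ublock det_mx11 rownormE.
Qed.

(** Cramer's rule for [coefs *m gram U = v *m adj U]. Putting the right-hand side into row [i] of
    [gram U] amounts to replacing row [i] of its left factor by [v], and the cofactors along that
    row stay the same. *)
Lemma coefs_cramer i :
  coefs 0 i * \det (gram U) =
  \det ((\matrix_(j < N) if j == i then v else row j U) *m adj U).
Proof.
set W := \matrix_(j < N) _.
rewrite [RHS](expand_det_row _ i).
have -> : coefs = (\det (gram U))^-1 *: (v *m adj U *m \adj (gram U)).
  by rewrite /coefs /invmx uG scalemxAr.
rewrite mxE mulrAC mulVf ?mul1r; last by rewrite -unitfE -unitmxE.
rewrite mxE; apply: eq_bigr => j _; congr (_ * _).
  by rewrite !mxE; apply: eq_bigr => k _; rewrite !mxE eqxx.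
rewrite mxE; congr (_ * \det _); apply/matrixP=> a b; rewrite !mxE.
apply: eq_bigr => k _; congr (_ * _).
by rewrite /W [RHS]mxE [_ == i]eq_sym (negbTE (neq_lift i a)) mxE.
Qed.

End Residual.

(** By Pythagoras the residual is no longer than [v]. If the rows of [U] are dependent, so are those
    of the enlarged matrix, whose Gram determinant then vanishes. *)
Lemma det_gram_col_le N g (U : 'M[C]_(N, g)) (v : 'rV[C]_g) :
  \det (gram (col_mx v U)) <= rownorm v * \det (gram U).
Proof.
have [uG|nuG] := boolP (gram U \in unitmx).
  rewrite det_gram_col // ler_wpM2r ?det_gram_ge0 //.
  have -> : rownorm v = rownorm (resid U v) + rownorm (coefs U v *m U).
    rewrite -!rownormE; set r := resid U v; set w := coefs U v *m U.
    have -> : v *m adj v = r *m adj r + w *m adj w; last by rewrite mxE.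
    have {1 2}-> : v = r + w by rewrite subrK.
    have aD : adj (r + w) = adj r + adj w by rewrite /adj linearD map_mxD.
    have rw0 : r *m adj w = 0 by rewrite /w adjM mulmxA resid_orth // mul0mx.
    have wr0 : w *m adj r = 0 by rewrite /w -mulmxA orth_resid // mulmx0.
    by rewrite aD mulmxDl !mulmxDr rw0 wr0 addr0 add0r.
  by rewrite lerDl rownorm_ge0.
suff -> : \det (gram (col_mx v U)) = 0 by rewrite mulr_ge0 ?rownorm_ge0 ?det_gram_ge0.
apply/eqP; apply: contraNT nuG => d0; apply: gram_unit.
have /unit_gram f : gram (col_mx v U) \in unitmx by rewrite unitmxE unitfE.
rewrite -kermx_eq0; apply/eqP.
have : row_mx 0 (kermx U) *m col_mx v U = 0 *m col_mx v U.
  by rewrite mul_row_col mulmx_ker !mul0mx addr0.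
by move/(row_free_inj f)/(congr1 rsubmx); rewrite row_mxKr linear0.
Qed.

(** Hadamard's inequality in Gram form, splitting off one row at a time with [det_gram_col_le]. *)
Lemma det_gram_le N g (U : 'M[C]_(N, g)) : \det (gram U) <= \prod_i rownorm (row i U).
Proof.
elim: N U => [|N IHN] U; first by rewrite det_mx00 big_ord0.
rewrite -[U](@vsubmxK _ 1 N) big_ord_recl.
apply: le_trans (det_gram_col_le _ _) _.
have -> : row ord0 (col_mx (usubmx (m1:=1) U) (dsubmx (m1:=1) U)) = usubmx (m1:=1) U.
  by apply/rowP => k; rewrite vsubmxK !mxE; congr (U _ _); apply: val_inj.
rewrite ler_wpM2l ?rownorm_ge0 //; apply: le_trans (IHN _) _.
rewrite le_eqVlt; apply/orP; left; apply/eqP.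
apply: eq_bigr => i _; congr rownorm; apply/rowP => k.
by rewrite vsubmxK !mxE; congr (U _ _); apply: val_inj.
Qed.

Lemma hadamard N (E : 'M[C]_N) : (forall i j, `|E i j| <= 1) ->
  `|\det E| ^+ 2 <= (N ^ N)%:R.
Proof.
move=> E1; have -> : `|\det E| ^+ 2 = \det (gram E).
  by rewrite det_mulmx det_adj normCK.
apply: le_trans (det_gram_le E) _.
rewrite natrX -[X in _ ^+ X](card_ord N) -prodr_const.
apply: ler_prod => i _; rewrite rownorm_ge0 /=.
rewrite -[X in _ <= X%:R](card_ord N) -sumr_const.
by apply: ler_sum => k _; rewrite mxE exprn_ile1.
Qed.

End Gram.

(** * Sums over injective tuples *)

Section ElementarySums.
Variables (C : numClosedFieldType) (g : nat) (lam : 'I_g -> C).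
Hypothesis lam_gt0 : forall k, 0 < lam k.

(** This is [N!] times the elementary symmetric polynomial of degree [N] in [lam]; ordered tuples
    match the form of Cauchy-Binet used here. *)
Definition injsum N : C :=
  \sum_(S : {ffun 'I_N -> 'I_g} | injectiveb S) \prod_i lam (S i).

Lemma prodlam_ge0 N (S : 'I_N -> 'I_g) : 0 <= \prod_i lam (S i).
Proof. by apply: prodr_ge0 => i _; apply: ltW. Qed.

Lemma injsum_ge0 N : 0 <= injsum N.
Proof. by apply: sumr_ge0 => S _; apply: prodlam_ge0. Qed.

Lemma injsum_gt0 N : (N <= g)%N -> 0 < injsum N.
Proof.
move=> Ng; pose S0 := [ffun i : 'I_N => widen_ord Ng i].
have iS0 : injectiveb S0.
  apply/injectiveP => i j; rewrite !ffunE => /(congr1 val) /= h; exact: val_inj.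
rewrite /injsum (bigD1 S0) //= ltr_pwDl //.
  by apply: prodr_gt0 => i _.
by apply: sumr_ge0 => S _; apply: prodlam_ge0.
Qed.

Variable F : {set 'I_g}.
Let tail := \sum_(k | k \notin F) lam k.

(** Coordinate [i] is split off and summed freely over the complement of [F]; dropping the condition
    that it differs from the other coordinates only enlarges the sum. *)
Lemma injsum_fixed_coord N (i : 'I_N.+1) :
  \sum_(S : {ffun 'I_N.+1 -> 'I_g} | injectiveb S && (S i \notin F)) \prod_j lam (S j)
  <= tail * injsum N.
Proof.
pose glue (p : 'I_g * {ffun 'I_N -> 'I_g}) : {ffun 'I_N.+1 -> 'I_g} :=
  [ffun j => if unlift i j is Some j' then p.2 j' else p.1].
pose cut (S : {ffun 'I_N.+1 -> 'I_g}) := (S i, [ffun j => S (lift i j)]).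
have cutK : cancel cut glue.
  move=> S; apply/ffunP => j; rewrite ffunE /=.
  by case: unliftP => [j'|] ->; rewrite ?ffunE.
have glueK : cancel glue cut.
  move=> [k S]; rewrite /cut /glue ffunE unlift_none /=; congr (_, _).
  by apply/ffunP => j; rewrite !ffunE liftK.
rewrite (reindex glue) /=; last by exists cut => x _.
rewrite /tail /injsum big_distrlr /= pair_big /=.
rewrite big_mkcond [X in _ <= X]big_mkcond /=; apply: ler_sum => -[k S] _ /=.
have -> : \prod_j lam (glue (k, S) j) = lam k * \prod_j lam (S j).
  rewrite (bigD1_ord i) //= ffunE unlift_none /=; congr (_ * _).
  by apply: eq_bigr => j _; rewrite ffunE liftK.
have pos : 0 <= lam k * \prod_j lam (S j) by rewrite mulr_ge0 ?prodlam_ge0 ?ltW.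
have -> : glue (k, S) i = k by rewrite ffunE unlift_none.
case: ifP => [/andP[/injectiveP inj kF]|_]; last by case: ifP.
suff iS : injectiveb S by rewrite kF iS.
apply/injectiveP => a b ab; apply: (@lift_inj _ i); apply: inj.
by rewrite !ffunE !liftK.
Qed.

(** Double counting: an injective tuple of length [N+1] has at most [m] coordinates in [F], hence at
    least [N+1-m] outside, and is counted that often when [injsum_fixed_coord] is summed over
    [i]. *)
Lemma injsum_step m N : (#|F| <= m)%N -> (m <= N)%N ->
  (N.+1 - m)%:R * injsum N.+1 <= N.+1%:R * (tail * injsum N).
Proof.
move=> Fm mN.
apply: (@le_trans _ _ (\sum_(i < N.+1)
  \sum_(S : {ffun 'I_N.+1 -> 'I_g} | injectiveb S && (S i \notin F)) \prod_j lam (S j))).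
  under [X in _ <= X]eq_bigr do rewrite big_mkcondr.
  rewrite exchange_big /= mulr_sumr; apply: ler_sum => S /injectiveP iS.
  rewrite -big_mkcond /= sumr_const -[X in _ <= X]mulr_natl.
  rewrite ler_wpM2r ?prodlam_ge0 // ler_nat leq_subLR.
  rewrite -[X in (X <= _)%N](card_ord N.+1) -(cardC (fun i => S i \in F)).
  rewrite leq_add //.
  apply: leq_trans Fm; rewrite -(card_image iS).
  by apply: subset_leq_card; apply/subsetP => k /imageP[i iF ->].
rewrite -[N.+1 in X in _ <= X]card_ord mulr_natl -sumr_const.
by apply: ler_sum => i _; apply: injsum_fixed_coord.
Qed.

(** Iterating [injsum_step] from length [m] collects the factors [(m+r+1)/(r+1)], whose product is
    the binomial coefficient. *)
Lemma injsum_bin m r : (#|F| <= m)%N ->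
  injsum (m + r) <= 'C(m + r, m)%:R * (tail ^+ r * injsum m).
Proof.
move=> Fm; elim: r => [|r IH]; first by rewrite addn0 binn expr0 !mul1r.
have t0 : 0 <= tail by apply: sumr_ge0 => k _; apply: ltW.
have := injsum_step Fm (leq_addr r m).
rewrite -addnS [in X in X%:R * injsum _]addKn => h.
rewrite -(ler_pM2l (x := r.+1%:R)) ?ltr0n //; apply: le_trans h _.
have -> : r.+1%:R * ('C(m + r.+1, m)%:R * (tail ^+ r.+1 * injsum m)) =
   (m + r.+1)%:R * (tail * ('C(m + r, m)%:R * (tail ^+ r * injsum m))).
  rewrite addnS; have := mul_bin_down (m + r).+1 m.
  rewrite /= subSn ?leq_addr // addKn => /(congr1 (fun x => x%:R : C)); rewrite !natrM => E.
  rewrite mulrA -E exprS. ring.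
by rewrite !ler_wpM2l ?ler0n.
Qed.

End ElementarySums.
Arguments injsum {C g} lam N.

Lemma bin_le_pow n k : (k <= n)%N -> ('C(n, k) <= 2 ^ n)%N.
Proof.
move=> kn; rewrite -[2%N]/(1 + 1)%N expnDn (bigD1 (Ordinal (kn : (k < n.+1)%N))) //=.
by rewrite !exp1n !muln1 leq_addr.
Qed.

(** With [N+1] in place of [N], the power is at most the product [(N+1)...(2N+1)], which equals
    [binom(2N+1, N+1) (N+1)!], and the binomial coefficient is at most [2^(2N+1)]. *)
Lemma expn_fact N : (N ^ N <= 4 ^ N * N`!)%N.
Proof.
case: N => // N.
have h k : (N.+1 ^ k <= (N + k) ^_ k)%N.
  elim: k => // k IH; rewrite expnS addnS ffactSS leq_mul //.
  by rewrite ltnS leq_addr.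
apply: leq_trans (h N.+1) _; rewrite -bin_ffact leq_mul2r; apply/orP; right.
apply: (@leq_trans (2 ^ (N + N.+1))).
  by rewrite bin_le_pow // leq_addl.
by rewrite -[4%N]/(2 ^ 2)%N -expnM leq_exp2l // mul2n -addnn leq_add2r.
Qed.

(** * Fekete points and the averaged kernel bound *)

(** The order of [C] is only partial, so the values are required to be real for a maximizer to
    exist. *)
Lemma real_argmax (C : numDomainType) (I : finType) (P : pred I) (f : I -> C) (i0 : I) :
  P i0 -> (forall i, f i \is Num.real) -> exists2 i, P i & forall j, P j -> f j <= f i.
Proof.
move=> P0 fr; have [i Pi h] := @real_arg_maxP C I i0 P f P0 (fun i _ => fr i).
by exists i.
Qed.

(** Induction on [n], adjoining to [F] a maximizer on its complement. The threshold [t] is the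
    [(n+1)]-st largest value. *)
Lemma top_set (C : numDomainType) (g n : nat) (f : 'I_g -> C) :
  (forall i, f i \is Num.real) -> (n < g)%N ->
  exists (F : {set 'I_g}) (t : C), [/\ #|F| = n, exists2 l, l \notin F & t = f l,
    forall k, k \in F -> t <= f k & forall l, l \notin F -> f l <= t].
Proof.
move=> fr; elim: n => [|n IH] ng.
  have [l _ h] := @real_argmax C 'I_g predT f (Ordinal ng) isT fr.
  exists set0, (f l); split; rewrite ?cards0 //; first by exists l; rewrite ?inE.
    by move=> k; rewrite inE.
  by move=> k _; apply: h.
have [F [t [cF [l lF tE] tF Ft]]] := IH (ltnW ng).
have [l' l'F] : exists l', l' \notin l |: F.
  have : (#|l |: F| < #|'I_g|)%N by rewrite cardsU1 lF cF card_ord.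
  case: (pickP [pred x | x \notin l |: F]) => [x xF _|all]; first by exists x.
  rewrite -cardsT; have -> : l |: F = [set: 'I_g]; last by rewrite ltnn.
  by apply/setP => x; rewrite [RHS]inE; apply/negbNE/negbT; apply: all.
have [m mF hm] := @real_argmax C 'I_g (fun x => x \notin l |: F) f l' l'F fr.
exists (l |: F), (f m); split.
- by rewrite cardsU1 lF cF.
- by exists m.
- move=> k; move: (mF); rewrite !inE negb_or => /andP[_ mF'].
  have mt := Ft _ mF'; case/orP => [/eqP ->|kF]; first by rewrite -tE.
  exact: le_trans mt (tF _ kF).
- by move=> k kF; apply: hm.
Qed.

(** Bathtub principle: for weights in [[0, 1]] of total mass at least [g - n], the weighted sum is
    least when the mass avoids the [n] largest [lam k]. *)
Lemma weighted_tail (C : numDomainType) (g n : nat) (lam p : 'I_g -> C) (F : {set 'I_g}) (t : C) :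
  #|F| = n -> 0 <= t -> (forall k, k \in F -> t <= lam k) ->
  (forall l, l \notin F -> lam l <= t) -> (forall k, 0 <= p k <= 1) ->
  g%:R - n%:R <= \sum_k p k ->
  \sum_(k | k \notin F) lam k <= \sum_k lam k * p k.
Proof.
move=> cF t0 tF Ft p01 hp; rewrite -subr_ge0.
(* Both kinds of terms are compared with the threshold: [lam k * p k >= t * p k] on [F], and
   [lam k * (p k - 1) >= t * (p k - 1)] off [F], where [p k - 1] is nonpositive. *)
apply: (@le_trans _ _ (t * (\sum_k p k - (g%:R - n%:R)))).
  by rewrite mulr_ge0 // subr_ge0.
have -> : g%:R - n%:R = \sum_(k | k \notin F) (1 : C).
  rewrite sumr_const -cF; apply/eqP; rewrite subr_eq -natrD -[X in X%:R == _](card_ord g).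
  by rewrite -(cardC (mem F)) addnC.
rewrite (bigID (fun k => k \in F)) /= -addrA -sumrB.
rewrite [X in _ <= X - _](bigID (fun k => k \in F)) /= -addrA -sumrB.
rewrite mulrDr !mulr_sumr; apply: lerD; apply: ler_sum => k kF.
  by rewrite ler_wpM2r ?tF //; case/andP: (p01 k).
have -> : lam k * p k - lam k = lam k * (p k - 1) by rewrite mulrBr mulr1.
by rewrite ler_wnM2r ?Ft // subr_le0; case/andP: (p01 k).
Qed.

(** * Kernel matrices on a finite node set with orthogonal characters *)

Section Sampling.
Variables (C : numClosedFieldType) (g q : nat) (s : 'I_g -> C) (e : 'I_q -> 'I_g -> C).
Hypothesis s_gt0 : forall k, 0 < s k.
Hypothesis e_norm : forall y k, `|e y k| = 1.
Hypothesis e_orth : forall k l, \sum_y e y k * (e y l)^* = if k == l then q%:R else 0.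
Variable y0 : 'I_q.

Let lam k := s k ^+ 2.

Let lam_gt0 k : 0 < lam k. Proof. exact: exprn_gt0. Qed.

(** The inner product of [feature y] and [feature z] is the reproducing kernel at the two nodes, so
    [vol X] below is the determinant of the kernel matrix. *)
Definition feature y : 'rV[C]_g := \row_k (s k * e y k).
Definition sampmx N (X : {ffun 'I_N -> 'I_q}) : 'M[C]_(N, g) :=
  \matrix_(i, k) (s k * e (X i) k).
Definition vol N (X : {ffun 'I_N -> 'I_q}) : C := \det (gram (sampmx X)).

Let minor N (X : {ffun 'I_N -> 'I_q}) (S : {ffun 'I_N -> 'I_g}) : 'M[C]_N :=
  \matrix_(i, j) e (X i) (S j).

Let det_minor_noninj N (X : {ffun 'I_N -> 'I_q}) (S : {ffun 'I_N -> 'I_g}) :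
  ~~ injectiveb S -> \det (minor X S) = 0.
Proof.
move=> /injectivePn[a [b ab Sab]]; rewrite -det_tr.
by apply: (determinant_alternate ab) => i; rewrite !mxE Sab.
Qed.

(** Cauchy-Binet with the diagonal factor [s] pulled out of each minor; a tuple with a repetition
    gives two equal columns and drops out. *)
Let vol_minors N (X : {ffun 'I_N -> 'I_q}) :
  N`!%:R * vol X = \sum_(S : {ffun 'I_N -> 'I_g} | injectiveb S)
     (\prod_j lam (S j)) * `|\det (minor X S)| ^+ 2.
Proof.
rewrite /vol -sum_det_colsub [RHS]big_mkcond /=; apply: eq_bigr => S _.
have -> : colsub S (sampmx X) = minor X S *m diag_mx (\row_j s (S j)).
  by apply/matrixP => i j; rewrite mul_mx_diag !mxE mulrC.
rewrite det_mulmx det_diag normrM exprMn.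
case: ifPn => [_|/det_minor_noninj ->]; last by rewrite normr0 expr0n mul0r.
rewrite mulrC; congr (_ * _); rewrite normr_prod -prodrXl; apply: eq_bigr => j _.
by rewrite mxE ger0_norm // ltW.
Qed.

Lemma vol_ge0 N (X : {ffun 'I_N -> 'I_q}) : 0 <= vol X.
Proof. exact: det_gram_ge0. Qed.

(** The entries of each minor have modulus one, so Hadamard bounds it by [N^N], and [N^N / N!] is at
    most [4^N]. *)
Lemma vol_le N (X : {ffun 'I_N -> 'I_q}) : vol X <= (4 ^ N)%:R * injsum lam N.
Proof.
have F0 := fact_gt0R C N.
rewrite -(ler_pM2l F0) vol_minors mulrA -natrM [(_ * 4 ^ N)%N]mulnC.
apply: (@le_trans _ _ ((N ^ N)%:R * injsum lam N)); last first.
  by rewrite ler_wpM2r ?injsum_ge0 // ler_nat expn_fact.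
rewrite /injsum mulr_sumr; apply: ler_sum => S _; rewrite [X in _ <= X]mulrC.
rewrite ler_wpM2l ?prodlam_ge0 //; apply: hadamard => i j.
by rewrite mxE e_norm.
Qed.

(* Cauchy-Binet a second time, now with the nodes as column indices. *)
Lemma sum_vol N :
  \sum_(X : {ffun 'I_N -> 'I_q}) vol X = (q ^ N)%:R * injsum lam N.
Proof.
have F0 := fact_gt0R C N.
apply: (mulfI (lt0r_neq0 F0)); rewrite mulr_sumr.
under eq_bigr do rewrite vol_minors.
rewrite exchange_big /= mulrA [_ * (q ^ N)%:R]mulrC -mulrA /injsum !mulr_sumr.
apply: eq_bigr => S /injectiveP iS; rewrite -mulr_sumr.
pose B : 'M[C]_(N, q) := \matrix_(j, y) e y (S j).
have -> : \sum_(X : {ffun 'I_N -> 'I_q}) `|\det (minor X S)| ^+ 2 = N`!%:R * \det (gram B).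
  rewrite -sum_det_colsub; apply: eq_bigr => X _; rewrite -det_tr.
  by congr (`|\det _| ^+ 2); apply/matrixP => i j; rewrite !mxE.
have -> : gram B = q%:R%:M.
  apply/matrixP => i j; rewrite !mxE.
  under eq_bigr do rewrite !mxE.
  by rewrite e_orth (inj_eq iS) mulrb.
by rewrite det_scalar -natrX; ring.
Qed.

Definition fekete N : {ffun 'I_N -> 'I_q} :=
  [arg max_(X > [ffun=> y0] : {ffun 'I_N -> 'I_q}) vol X]%O.

Lemma fekete_max N (X : {ffun 'I_N -> 'I_q}) : vol X <= vol (fekete N).
Proof.
rewrite /fekete; case: real_arg_maxP => // [Y _|Y _ h]; last exact: h.
exact: ger0_real (vol_ge0 Y).
Qed.

(** A maximum is at least the average, which [sum_vol] computes. *)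
Lemma fekete_ge N : injsum lam N <= vol (fekete N).
Proof.
have q0 : (0 < q)%N by case: (q) y0 => // -[].
rewrite -(ler_pM2l (x := (q ^ N)%:R)) ?ltr0n ?expn_gt0 ?q0 // -sum_vol.
have -> : (q ^ N)%:R * vol (fekete N) = \sum_(X : {ffun 'I_N -> 'I_q}) vol (fekete N).
  by rewrite sumr_const card_ffun !card_ord mulr_natl.
by apply: ler_sum => X _; apply: fekete_max.
Qed.

Let extend N (X : {ffun 'I_N -> 'I_q}) y : {ffun 'I_N.+1 -> 'I_q} :=
  [ffun i => if unlift ord0 i is Some j then X j else y].

Let sampmx_extend N (X : {ffun 'I_N -> 'I_q}) y :
  sampmx (extend X y) = col_mx (feature y) (sampmx X).
Proof.
apply/matrixP => i k; rewrite [LHS]mxE ffunE; case: unliftP => [j|] ->.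
  have -> : lift ord0 j = rshift 1 j by apply: val_inj.
  by apply: etrans (esym (col_mxEd (feature y) (sampmx X) j k)); rewrite mxE.
have -> : ord0 = lshift N (ord0 : 'I_1) by apply: val_inj.
by apply: etrans (esym (col_mxEu (feature y) (sampmx X) ord0 k)); rewrite mxE.
Qed.

(** For data vanishing on [X] this bounds the value at any node by [sqrt tau]. The sum of samples is
    kept because truncated functions vanish on the nodes only approximately. *)
Definition power_bound N (X : {ffun 'I_N -> 'I_q}) (tau : C) :=
  forall y (b : 'I_g -> C), \sum_k `|b k| ^+ 2 <= 1 ->
  `|\sum_k s k * e y k * b k| <=
  sqrtC tau + \sum_i `|\sum_k s k * e (X i) k * b k|.

(** [feature y] is split into its residual and a combination of the features at the nodes. The
    residual contributes at most [sqrt tau], and the coefficients, which are Lagrange functions at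
    Fekete points, are bounded by one. *)
Lemma maximal_power_bound N (X : {ffun 'I_N -> 'I_q}) (tau : C) :
  0 <= tau -> 0 < vol X -> (forall X' : {ffun 'I_N -> 'I_q}, vol X' <= vol X) ->
  (forall X' : {ffun 'I_N.+1 -> 'I_q}, vol X' <= tau * vol X) -> power_bound X tau.
Proof.
move=> tau0 V0 Xmax Xnext y b b1.
set U := sampmx X; have uG : gram U \in unitmx.
  by rewrite unitmxE unitfE lt0r_neq0.
set v := feature y; set r := resid U v; set a := coefs U v.
pose bc := \col_k b k.
have hE (i : 'I_N) : (U *m bc) i 0 = \sum_k s k * e (X i) k * b k.
  by rewrite mxE; apply: eq_bigr => k _; rewrite !mxE.
have vE : (v *m bc) 0 0 = \sum_k s k * e y k * b k.
  by rewrite mxE; apply: eq_bigr => k _; rewrite !mxE.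
(* By Cramer the numerator is a mixed Gram determinant for [X] and for [X] with node [i] moved to
   [y]; maximality bounds both volumes by [vol X]. *)
have a1 i : `|a 0 i| <= 1.
  have := coefs_cramer v uG i; set W := \matrix_(j < N) _ => aE.
  have WE : W = sampmx [ffun j => if j == i then y else X j].
    by apply/matrixP => j k; rewrite !mxE ffunE; case: eqP => _; rewrite !mxE.
  have : `|a 0 i * vol X| ^+ 2 <= vol X ^+ 2.
    rewrite aE; apply: le_trans (det_mixed_gram _ _) _; rewrite expr2.
    by rewrite ler_wpM2r ?vol_ge0 // WE; apply: Xmax.
  rewrite ler_sqr ?nnegrE ?normr_ge0 ?vol_ge0 // normrM (gtr0_norm V0).
  by rewrite ger_pMl.
(* The squared residual is the ratio of the volume with [y] added to the volume of [X]. *)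
have rtau : rownorm r <= tau.
  by rewrite -(ler_pM2r V0) -(det_gram_col v uG) -sampmx_extend; apply: Xnext.
rewrite -vE; have -> : v = r + a *m U by rewrite subrK.
rewrite mulmxDl mxE; apply: le_trans (ler_normD _ _) _; apply: lerD.
  rewrite -(ler_sqr (x := `|_|)) ?nnegrE ?normr_ge0 ?sqrtC_ge0 // sqrtCK.
  apply: le_trans rtau.
  have := cauchy_schwarz (fun k => r 0 k) (fun k => (b k)^*).
  have -> : \sum_k r 0 k * (b k)^*^* = (r *m bc) 0 0.
    by rewrite mxE; apply: eq_bigr => k _; rewrite conjCK [bc _ _]mxE.
  move/le_trans; apply; rewrite -/(rownorm r) ler_piMr ?rownorm_ge0 //.
  by apply: le_trans b1; apply: ler_sum => k _; rewrite norm_conjC.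
rewrite -mulmxA mxE; apply: le_trans (ler_norm_sum _ _ _) _.
by apply: ler_sum => i _; rewrite hE normrM ler_piMl.
Qed.

(** If no length in [[m, 2m)] had growth ratio at most [tau], the volume at [2m] would exceed
    [tau^m * injsum lam m]. The upper bound is [4^(2m)] from [vol_le] times [4^m] from the binomial
    coefficient, whence the constant [64 = 4^3]. *)
Lemma exists_sampling (F : {set 'I_g}) m : (0 < m <= g)%N -> (#|F| <= m)%N ->
  exists N (X : {ffun 'I_N -> 'I_q}), (N <= m.*2)%N /\
    power_bound X (64 * \sum_(k | k \notin F) lam k).
Proof.
move=> /andP[m0 mg] Fm; set tail := \sum_(k | _) _; set tau := 64 * tail.
have tail0 : 0 <= tail by apply: sumr_ge0 => k _; apply: ltW.
have tau0 : 0 <= tau by rewrite mulr_ge0 ?ler0n.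
have [/existsP[r /andP[V0 step]]|none] :=
    boolP [exists r : 'I_m, (0 < vol (fekete (m + r)%N)) &&
      (vol (fekete (m + r).+1) <= tau * vol (fekete (m + r)%N))].
  exists (m + r)%N, (fekete (m + r)%N); split.
    by rewrite -addnn leq_add2l ltnW.
  apply: maximal_power_bound => // X'; first exact: fekete_max.
  by apply: le_trans step; apply: fekete_max.
(* At [r = 0] only the weak inequality is available; it becomes strict from the first step on, and
   [m > 0] guarantees one. *)
have grow r : (r <= m)%N -> 0 < vol (fekete (m + r)%N) /\
   (if r == 0 then injsum lam m <= vol (fekete m)
    else tau ^+ r * injsum lam m < vol (fekete (m + r)%N)).
  elim: r => [|r IH] rm.
    rewrite addn0 eqxx; split; last exact: (fekete_ge m).
    by apply: lt_le_trans (fekete_ge m); apply: injsum_gt0.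
  have [V0 IHr] := IH (ltnW rm).
  have : tau * vol (fekete (m + r)%N) < vol (fekete (m + r).+1).
    rewrite real_ltNge ?ger0_real ?vol_ge0 ?mulr_ge0 ?vol_ge0 //.
    apply/negP => h; move/negP: none; apply.
    by apply/existsP; exists (Ordinal rm); rewrite /= V0 h.
  rewrite addnS => lt; split.
    by apply: le_lt_trans lt; rewrite mulr_ge0 ?vol_ge0.
  rewrite /=; apply: le_lt_trans lt; rewrite exprS -mulrA ler_wpM2l //.
  move: IHr; case: eqP => [->|_ /ltW //]; by rewrite expr0 mul1r addn0.
have [_] := grow m (leqnn m); rewrite eqn0Ngt m0 /= => lt.
suff : vol (fekete (m + m)%N) <= tau ^+ m * injsum lam m.
  by move/(lt_le_trans lt); rewrite ltxx.
apply: le_trans (vol_le _) _.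
apply: (@le_trans _ _ ((4 ^ (m + m))%:R * ((4 ^ m)%:R * (tail ^+ m * injsum lam m)))).
  rewrite ler_wpM2l ?ler0n //; apply: le_trans (injsum_bin lam_gt0 m Fm) _.
  rewrite ler_wpM2r ?mulr_ge0 ?exprn_ge0 ?injsum_ge0 // ler_nat.
  apply: leq_trans (bin_le_pow (leq_addr _ _)) _.
  by rewrite -[4%N]/(2 ^ 2)%N -expnM mul2n -addnn.
rewrite le_eqVlt; apply/orP; left; apply/eqP.
rewrite /tau exprMn !mulrA; congr (_ * _ * _).
by rewrite -natrM -[64]/(64%:R) -natrX expnD -!expnMn.
Qed.

(** At a node [y], the best normalized element of the kernel of [U] is the conjugate of [feature y]
    projected off the rows of [U]. Its squared value is the squared norm of that projection; the
    best node does at least as well as the average. *)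
Lemma kernel_lower_bound n (U : 'M[C]_(n, g)) (F : {set 'I_g}) (t : C) :
  #|F| = n -> 0 <= t -> (forall k, k \in F -> t <= lam k) ->
  (forall l, l \notin F -> lam l <= t) ->
  exists y (b : 'I_g -> C), [/\ U *m (\col_k b k) = 0, \sum_k `|b k| ^+ 2 <= 1 &
    \sum_(k | k \notin F) lam k <= `|\sum_k s k * e y k * b k| ^+ 2].
Proof.
move=> cF t0 tF Ft.
(* The rows of [U] may be dependent, while the projection formula needs an invertible Gram
   matrix. *)
pose U' := row_base U; have uG : gram U' \in unitmx by rewrite gram_unit ?row_base_free.
pose M := 1%:M - adj U' *m invmx (gram U') *m U'.
have rM v : resid U' v = v *m M by rewrite /resid /coefs /M mulmxBr mulmx1 !mulmxA.
have normM v : rownorm (v *m M) = (v *m M *m adj v) 0 0.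
  by rewrite -rM -rownormE resid_norm.
(* [M] is the orthogonal projection off the rows of [U'], so its diagonal is in [0, 1]. *)
have Mkk k : M k k = \sum_l `|M k l| ^+ 2.
  have := normM (delta_mx 0 k); rewrite -rowE /rownorm => h.
  transitivity (\sum_l `|row k M 0 l| ^+ 2); last by apply: eq_bigr => l _; rewrite mxE.
  rewrite h [RHS]mxE (bigD1 k) //= big1 => [|l lk].
    by rewrite !mxE !eqxx conjC1 mulr1 addr0.
  by rewrite !mxE eqxx (negbTE lk) conjC0 mulr0.
have Mge0 k : 0 <= M k k by rewrite Mkk; apply: sumr_ge0 => l _; rewrite exprn_ge0.
have Mle1 k : M k k <= 1.
  have [->|n0] := eqVneq (M k k) 0; first exact: ler01.
  have Mgt : 0 < M k k by rewrite lt_def n0 Mge0.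
  rewrite -(ler_pM2l Mgt) mulr1 [X in _ <= X]Mkk (bigD1 k) //= ger0_norm // -expr2.
  by rewrite lerDl; apply: sumr_ge0 => l _; rewrite exprn_ge0.
(* The trace of a projection is its rank, here [g] minus the rank of [U]. *)
have trM : g%:R - n%:R <= \sum_k M k k.
  have -> : \sum_k M k k = \tr M by [].
  rewrite /M linearB /= mxtrace1 -mulmxA mxtrace_mulC -mulmxA -/(gram U') mulVmx //.
  by rewrite mxtrace1 lerD2l lerN2 ler_nat rank_leq_row.
have low : \sum_(k | k \notin F) lam k <= \sum_k lam k * M k k.
  by apply: (weighted_tail cF t0) => // k; rewrite Mge0 Mle1.
have [y _ ymax] := @real_argmax C _ predT (fun y => rownorm (feature y *m M)) y0 isT
   (fun y => ger0_real (rownorm_ge0 _)).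
have q0 : (0 < q)%N by case: (q) y0 => // -[].
(* Orthogonality makes [adj V *m V] diagonal with entries [q * lam k], so cyclicity of the trace
   turns the sum of squared norms over the nodes into the weighted diagonal of [M]. *)
have big : \sum_k lam k * M k k <= rownorm (feature y *m M).
  rewrite -(ler_pM2l (x := q%:R)) ?ltr0n //.
  rewrite [X in _ <= X]mulr_natl -[in X in _ <= X](card_ord q) -sumr_const.
  pose V : 'M[C]_(q, g) := \matrix_(z, k) (s k * e z k).
  have VV : adj V *m V = diag_mx (\row_k (q%:R * lam k)).
    apply/matrixP => k l; rewrite !mxE.
    transitivity (s k * s l * \sum_z e z l * (e z k)^*).
      rewrite mulr_sumr; apply: eq_bigr => z _; rewrite !mxE rmorphM /=.
      by rewrite (CrealP (ger0_real (ltW (s_gt0 k)))); ring.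
    rewrite e_orth eq_sym; case: eqP => [->|_]; last by rewrite mulr0 mulr0n.
    by rewrite mulr1n /lam expr2 mulrC.
  have -> : q%:R * \sum_k lam k * M k k = \sum_z rownorm (feature z *m M).
    transitivity (\tr (M *m (adj V *m V))).
      rewrite VV mulr_sumr /mxtrace; apply: eq_bigr => k _.
      by rewrite mul_mx_diag !mxE mulrA mulrC.
    rewrite mulmxA mxtrace_mulC mulmxA; apply: eq_bigr => z _.
    have -> : feature z = row z V by apply/rowP => k; rewrite !mxE.
    rewrite normM -row_mul !mxE; apply: eq_bigr => k _.
    by rewrite !mxE.
  by apply: ler_sum => z _; apply: ymax.
set r := feature y *m M in big; set rho := rownorm r in big.
have rho0 : 0 <= rho := rownorm_ge0 r.
have rE : resid U' (feature y) = r by rewrite rM.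
have Ur : U *m adj r = 0.
  have U'r : U' *m adj r = 0 by rewrite -rE orth_resid.
  have /submxP[W UE] : (U <= U')%MS by rewrite eq_row_base.
  by rewrite UE -mulmxA U'r mulmx0.
have fr : \sum_k s k * e y k * (r 0 k)^* = rho.
  rewrite /rho -rownormE -rE -[LHS]/(_ : C).
  have -> : resid U' (feature y) *m adj (resid U' (feature y)) =
            feature y *m adj (resid U' (feature y)).
    by rewrite {1}/resid mulmxBl -mulmxA orth_resid // mulmx0 subr0.
  by rewrite mxE; apply: eq_bigr => k _; rewrite !mxE.
have sr0 : 0 <= sqrtC rho by rewrite sqrtC_ge0.
have sV : (sqrtC rho)^-1 \is Num.real by rewrite ger0_real // invr_ge0.
(* When [rho = 0] the inverse root is [0] by convention, so [b] is zero and the bound reads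
   [0 <= 0]. *)
exists y, (fun k => (sqrtC rho)^-1 * (r 0 k)^*); split.
- have -> : \col_k ((sqrtC rho)^-1 * (r 0 k)^*) = (sqrtC rho)^-1 *: adj r.
    by apply/colP => k; rewrite !mxE.
  by rewrite -scalemxAr Ur scaler0.
- under eq_bigr do rewrite normrM norm_conjC exprMn.
  rewrite -mulr_sumr -/(rownorm r) -/rho normfV (ger0_norm sr0) exprVn sqrtCK.
  by have [->|n0] := eqVneq rho 0; rewrite ?mulr0 ?ler01 // mulVf.
- apply: le_trans low _; apply: le_trans big _.
  under eq_bigr do rewrite mulrCA.
  rewrite -mulr_sumr fr normrM normfV (ger0_norm sr0) (ger0_norm rho0) exprMn exprVn sqrtCK.
  have [->|n0] := eqVneq rho 0; first by rewrite expr0n mulr0.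
  by rewrite expr2 mulKf.
Qed.

End Sampling.

(** * Trigonometric polynomials on a product grid *)

Local Open Scope complex_scope.

Definition gridpt (Q : nat) (j : nat -> nat) : nat -> R :=
  fun i => (INR (j i) / INR Q)%coqR.

(** Bridge from Coquelicot's complex numbers to the field [R[i]], where the matrix results apply. *)
Definition toC (z : Coquelicot.Complex.C) : R[i] := Complex z.1 z.2.

Lemma toCD a b : toC (Cplus a b) = toC a + toC b. Proof. by []. Qed.
Lemma toCM a b : toC (Cmult a b) = toC a * toC b. Proof. by []. Qed.
Lemma toC_inj : injective toC.
Proof. by move=> [a b] [c d] [-> ->]. Qed.
Lemma toC_norm z : `|toC z| = (Cmod z)%:C.
Proof. by rewrite /Cmod RsqrtE /= !Rmult_1_r. Qed.

Definition cis (t : R) := toC (cis2pi t).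
Arguments cis t%_R.

Lemma cisD a b : cis (a + b) = cis a * cis b.
Proof.
rewrite /cis /cis2pi /toC /=; apply/eqP; rewrite eq_complex /=.
have -> : Rmult (Rmult 2 PI) (a + b) = Rplus (Rmult (Rmult 2 PI) a) (Rmult (Rmult 2 PI) b).
  exact: Rmult_plus_distr_l.
rewrite cos_plus sin_plus; apply/andP; split=> //.
by apply/eqP; rewrite !RplusE !RmultE; ring.
Qed.

Lemma cis0 : cis 0 = 1.
Proof. by rewrite /cis /cis2pi Rmult_0_r cos_0 sin_0. Qed.

Lemma Cmod_cis t : Cmod (cis2pi t) = 1%coqR.
Proof.
rewrite /Cmod /cis2pi /= !Rmult_1_r Rplus_comm.
have := sin2_cos2 (Rmult (Rmult 2 PI) t); rewrite /Rsqr => ->.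
exact: sqrt_1.
Qed.

Lemma norm_cis t : `|cis t| = 1.
Proof. by rewrite /cis toC_norm Cmod_cis. Qed.

Lemma conj_cis t : (cis t)^*%R = cis (- t).
Proof.
have n0 : cis t != 0 by rewrite -normr_eq0 norm_cis oner_eq0.
apply: (mulfI n0); rewrite -normCK norm_cis expr1n -cisD subrr cis0 //.
Qed.

Lemma cis_sum (I : Type) (r : seq I) (f : I -> R) :
  cis (\sum_(i <- r) f i) = \prod_(i <- r) cis (f i).
Proof. exact: (big_morph _ cisD cis0). Qed.

Lemma cisMn t n : cis (t * n%:R) = cis t ^+ n.
Proof. by rewrite mulr_natr -[in LHS](card_ord n) -sumr_const cis_sum prodr_const card_ord. Qed.

(** The double-angle formula turns [cos (2 PI t) = 1] into [sin (PI t) = 0]. *)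
Lemma cis_eq1 t : cis t = 1 -> exists m : Z, t = IZR m.
Proof.
case=> c1 _; have e : Rmult (Rmult 2 PI) t = Rmult 2 (Rmult PI t).
  by rewrite Rmult_assoc.
move: c1; rewrite e cos_2a_sin => h.
have s0 : sin (Rmult PI t) = 0%coqR.
  have : Rmult (sin (Rmult PI t)) (sin (Rmult PI t)) = 0%coqR.
    by move: h; set x := sin _; rewrite -[1%R]/1%coqR => h; Lra.lra.
  by case/Rmult_integral.
have [m hm] := sin_eq_0_0 _ s0; exists m.
have p0 : PI <> 0%coqR := PI_neq0.
by apply: (Rmult_eq_reg_l PI) => //; rewrite hm Rmult_comm.
Qed.

Lemma cis_Z (m : Z) : cis (IZR m) = 1.
Proof.
have h n : cis (INR n) = 1.
  rewrite INRE -[_%:R]mul1r cisMn.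
  suff -> : cis 1 = 1 by rewrite expr1n.
  by rewrite /cis /cis2pi Rmult_1_r cos_2PI sin_2PI.
case: (Z_le_gt_dec 0 m) => hm.
  by rewrite -(Z2Nat.id m) // -INR_IZR_INZ.
have : cis (IZR m) * cis (IZR (- m)%coqZ) = 1.
  by rewrite -cisD -RplusE -plus_IZR Z.add_opp_diag_r cis0.
have m0 : (0 <= - m)%coqZ by Lia.lia.
by rewrite -(Z2Nat.id (- m)) // -INR_IZR_INZ h mulr1.
Qed.

(** A geometric sum over a [Q]-th root of unity. The root equals one only if [Q] divides [m], and
    [|m| < Q] leaves only [m = 0]. *)
Lemma sum_cis_grid (m : Z) (Q : nat) : (Z.abs m < Z.of_nat Q)%coqZ ->
  \sum_(j < Q) cis (IZR m * (INR j / INR Q)%coqR) = if (m =? 0)%coqZ then Q%:R else 0.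
Proof.
move=> mQ; have Q0 : (0 < Q)%N by case: Q mQ => // mQ; exfalso; simpl in mQ; Lia.lia.
have QR : INR Q <> 0%coqR by apply: not_0_INR; case: (Q) Q0.
case: Z.eqb_spec => [->|m0].
  under eq_bigr do rewrite mul0r cis0.
  by rewrite sumr_const card_ord.
set z := cis (IZR m / INR Q)%coqR.
have zj (j : nat) : cis (IZR m * (INR j / INR Q)%coqR) = z ^+ j.
  rewrite -cisMn -INRE -!RmultE; congr cis; rewrite /Rdiv; Lra.lra.
under eq_bigr do rewrite zj.
have zQ : z ^+ Q = 1.
  rewrite -zj -RmultE; have -> : Rmult (IZR m) (Rdiv (INR Q) (INR Q)) = IZR m.
    by rewrite /Rdiv Rinv_r // Rmult_1_r.
  exact: cis_Z.
have z1 : z != 1.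
  apply/eqP => /cis_eq1[p hp]; apply: m0.
  have E : m = (p * Z.of_nat Q)%coqZ.
    apply: eq_IZR; rewrite mult_IZR -INR_IZR_INZ -hp /Rdiv Rmult_assoc Rinv_l //.
    by rewrite Rmult_1_r.
  by case: (Z.eq_dec p 0) => [p0|p0]; [rewrite E p0|exfalso; rewrite E in mQ; Lia.nia].
apply: (mulfI (x := z - 1)); first by rewrite subr_eq0.
by rewrite -subrX1 zQ subrr mulr0.
Qed.

Lemma rsum_big (A : Type) (l : list A) (a : A -> R) : rsum l a = \sum_(k <- l) a k.
Proof. by elim: l => [|x l IH] /=; rewrite ?big_nil ?big_cons // IH. Qed.

Lemma csum_big (A : Type) (l : list A) a : toC (csum l a) = \sum_(k <- l) toC (a k).
Proof. by elim: l => [|x l IH] /=; rewrite ?big_nil ?big_cons // toCD IH. Qed.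

Lemma seq_iota m n : List.seq m n = iota m n.
Proof. by elim: n m => //= n IH m; rewrite IH. Qed.

Lemma dot_big d k x : dot d k x = \sum_(i < d) IZR (k i) * x i.
Proof. by rewrite /dot rsum_big seq_iota -[X in iota 0 X](subn0 d) -/(index_iota 0 d) big_mkord. Qed.

(** The sum over the product grid factors into one-dimensional sums; the bound on the frequency
    differences excludes aliasing. *)
Lemma grid_orth d Q (k l : Zvec) :
  (forall i, (i < d)%coq_nat -> (Z.abs (k i - l i) < Z.of_nat Q)%coqZ) ->
  \sum_(y : {ffun 'I_d -> 'I_Q})
    cis (\sum_(i < d) IZR (k i) * (INR (y i) / INR Q)%coqR) *
    (cis (\sum_(i < d) IZR (l i) * (INR (y i) / INR Q)%coqR))^*%R
  = if [forall i : 'I_d, (k i =? l i)%coqZ] then (Q ^ d)%:R else 0.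
Proof.
move=> kl.
transitivity (\sum_(y : {ffun 'I_d -> 'I_Q}) \prod_(i < d)
    cis (IZR (k i - l i)%coqZ * (INR (y i) / INR Q)%coqR)).
  apply: eq_bigr => y _; rewrite conj_cis -cisD -cis_sum; congr cis.
  rewrite -sumrB; apply: eq_bigr => i _; rewrite -mulrBl; congr (_ * _).
  by rewrite minus_IZR.
rewrite -(bigA_distr_bigA (fun (i : 'I_d) (j : 'I_Q) =>
    cis (IZR (k i - l i)%coqZ * (INR j / INR Q)%coqR))) /=.
rewrite (eq_bigr (fun i : 'I_d => if (k i - l i =? 0)%coqZ then Q%:R else 0)); last first.
  by move=> i _; apply: sum_cis_grid; apply: kl; apply/ssrnat.ltP; exact: ltn_ord.
case: ifP => [/forallP h|/negbT].
  rewrite natrX -[X in _ ^+ X]card_ord -prodr_const; apply: eq_bigr => i _.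
  by have /Z.eqb_spec -> := h i; rewrite Z.sub_diag.
rewrite negb_forall => /existsP[i hi]; rewrite (bigD1 i) //=.
case: Z.eqb_spec => [h|_]; last by rewrite mul0r.
by move/Z.eqb_spec: hi; case; Lia.lia.
Qed.

Lemma nthE (T : Type) (x0 : T) l i : nth x0 l i = List.nth i l x0.
Proof. by elim: l i => [|x l IH] [|i] //=. Qed.

Lemma sizeE (T : Type) (l : list T) : size l = length l.
Proof. by elim: l => //= x l ->. Qed.

Lemma nth_In (T : Type) (x0 : T) (l : list T) (i : 'I_(size l)) : List.In (nth x0 l i) l.
Proof. by rewrite nthE; apply: List.nth_In; rewrite -sizeE; apply/ssrnat.ltP. Qed.

Lemma In_nth_ord (T : Type) (x0 : T) (l : list T) k :
  List.In k l -> exists i : 'I_(size l), nth x0 l i = k.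
Proof.
move=> kl; have [i [il ik]] := List.In_nth l k x0 kl.
have il' : (i < size l)%N by rewrite sizeE; apply/ssrnat.ltP.
by exists (Ordinal il'); rewrite nthE.
Qed.

Lemma nth_ord_inj (T : Type) (x0 : T) (l : list T) : List.NoDup l ->
  injective (fun i : 'I_(size l) => nth x0 l i).
Proof.
move=> nd i j; rewrite !nthE => h; apply: val_inj.
have lt (k : 'I_(size l)) : (k < length l)%coq_nat.
  by apply/ssrnat.ltP; rewrite -sizeE; apply: ltn_ord.
exact: (proj1 (List.NoDup_nth l x0) nd _ _ (lt i) (lt j) h).
Qed.

(** Frequencies are functions, so membership in [l] is decided classically; [NoDup] makes the chosen
    index unique. *)
Lemma extend_by_zero (l : list Zvec) (x0 : Zvec) (f : 'I_(size l) -> Coquelicot.Complex.C) :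
  List.NoDup l -> exists c : Coef, (forall i : 'I_(size l), c (nth x0 l i) = f i) /\
    (forall k, ~ List.In k l -> c k = RtoC 0).
Proof.
move=> nd.
pose c (k : Zvec) := match ClassicalEpsilon.excluded_middle_informative
    (exists i : 'I_(size l), nth x0 l i = k) with
  | left h => f (proj1_sig (ClassicalEpsilon.constructive_indefinite_description _ h))
  | right _ => RtoC 0 end.
exists c; split=> [i|k kl]; rewrite /c; case: ClassicalEpsilon.excluded_middle_informative => h.
- case: ClassicalEpsilon.constructive_indefinite_description => j /= ji.
  by congr f; apply: (nth_ord_inj nd ji).
- by case: h; exists i.
- by case: h => i ik; case: kl; rewrite -ik; apply: nth_In.
- by [].
Qed.

(** * Transfer of the finite-dimensional bounds to trigonometric polynomials *)

Section Transport.
Variables (d : nat) (w : Zvec -> R) (G : list Zvec) (Q : nat).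
Hypothesis GP : fin_index d G.
Hypothesis wP : forall k, List.In k G -> (0 < w k)%coqR.
Hypothesis Q_gt0 : (0 < Q)%coq_nat.
Hypothesis GQ : forall k l i, List.In k G -> List.In l G ->
  (Z.abs (k i - l i) < Z.of_nat Q)%coqZ.

Let k0 : Zvec := fun _ => Z0.
Let g := size G.
Let kk (i : 'I_g) : Zvec := nth k0 G i.
Let q := #|{: {ffun 'I_d -> 'I_Q}}|.

Let Q0 : (0 < Q)%N. Proof. exact/ssrnat.ltP. Qed.

Let wkk i : 0 < w (kk i).
Proof. by apply/RltP; apply: wP; apply: nth_In. Qed.

(** Grid points are numbered by a single index, as the matrix results require; coordinates from [d]
    on get the default [0]. *)
Definition node (y : 'I_q) (i : nat) : nat :=
  if insub i is Some i' then enum_val y i' : nat else 0%N.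

Definition trigpoly (c : Coef) (x : nat -> R) : Coquelicot.Complex.C :=
  csum G (fun k => Cmult (c k) (cis2pi (dot d k x))).

Let e (y : 'I_q) (i : 'I_g) := cis (dot d (kk i) (gridpt Q (node y))).
Let s (i : 'I_g) : R[i] := ((w (kk i))^-1)%:C.

Let node_lt y i : (i < d)%N -> (node y i < Q)%N.
Proof. by move=> id; rewrite /node insubT. Qed.

Let node_onto (j : nat -> nat) : (forall i, (i < d)%N -> (j i < Q)%N) ->
  exists y, forall i, (i < d)%N -> node y i = j i.
Proof.
move=> jQ; exists (enum_rank [ffun i : 'I_d => insubd (Ordinal Q0) (j i)]) => i id.
by rewrite /node insubT enum_rankK ffunE val_insubd jQ.
Qed.

Let dot_node k y : dot d k (gridpt Q (node y)) =
  \sum_(i < d) IZR (k i) * (INR (enum_val y i) / INR Q)%coqR.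
Proof.
rewrite dot_big; apply: eq_bigr => i _; congr (_ * _).
by rewrite /gridpt /node valK.
Qed.

Let s_gt0 i : 0 < s i. Proof. by rewrite ltcR invr_gt0 wkk. Qed.

Let e_norm y i : `|e y i| = 1. Proof. exact: norm_cis. Qed.

Let e_orth i l : \sum_y e y i * (e y l)^*%R = if i == l then q%:R else 0.
Proof.
rewrite /e; under eq_bigr do rewrite !dot_node.
transitivity (\sum_(y : {ffun 'I_d -> 'I_Q})
  cis (\sum_(a < d) IZR (kk i a) * (INR (y a) / INR Q)%coqR) *
  (cis (\sum_(a < d) IZR (kk l a) * (INR (y a) / INR Q)%coqR))^*%R).
  rewrite -(big_enum_val (fun y : {ffun 'I_d -> 'I_Q} =>
    cis (\sum_(a < d) IZR (kk i a) * (INR (y a) / INR Q)%coqR) *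
    (cis (\sum_(a < d) IZR (kk l a) * (INR (y a) / INR Q)%coqR))^*%R)) /=.
  exact: eq_bigl.
rewrite grid_orth => [|a _]; last by apply: GQ; apply: nth_In.
(* Agreement on the first [d] coordinates suffices, since all frequencies of [G] vanish beyond
   them. *)
have -> : [forall a : 'I_d, (kk i a =? kk l a)%coqZ] = (i == l).
  apply/forallP/eqP => [h|->]; last by move=> a; apply: Z.eqb_refl.
  apply: (nth_ord_inj (proj1 GP)); apply: FunctionalExtensionality.functional_extensionality => a.
  case: (ltnP a d) => ad; first exact/Z.eqb_spec/(h (Ordinal ad)).
  have sp b : kk b a = 0%coqZ.
    have [_ /List.Forall_forall F] := GP.
    by apply: (F (kk b)); [apply: nth_In|apply/ssrnat.leP].
  by have := sp i; have := sp l; rewrite /kk => -> ->.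
by rewrite /q card_ffun !card_ord.
Qed.

(** The substitution [b k = c k * w k] turns the weighted unit ball into the Euclidean one. *)
Let trigpolyE c y : toC (trigpoly c (gridpt Q (node y))) =
  \sum_i s i * e y i * (toC (c (kk i)) * (w (kk i))%:C).
Proof.
rewrite /trigpoly csum_big (big_nth k0) big_mkord; apply: eq_bigr => i _.
rewrite toCM -/(kk i) -/(cis _) -/(e y i) /s.
have : (w (kk i))%:C != 0 by rewrite (inj_eq (@complexI _)) gt_eqF.
by move=> w0; rewrite fmorphV; move: w0; set a := _%:C => w0; field.
Qed.

Let energyE (c : Coef) : (rsum G (fun k => (Cmod (c k) ^ 2 * w k ^ 2)%coqR))%:C =
  \sum_i `|toC (c (kk i)) * (w (kk i))%:C| ^+ 2.
Proof.
rewrite rsum_big (big_nth k0) big_mkord rmorph_sum; apply: eq_bigr => i _.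
rewrite normrM toC_norm (ger0_norm (x := _%:C)) ?lecR ?ltW //.
by rewrite !RpowE RmultE rmorphM !rmorphXn exprMn.
Qed.

(** [T^2] is the sum of [w^-2] over [G] without its [n] largest terms. The bound [t <= T^2] depends
    on [G0] only, so tolerances can be fixed before [G] is enlarged. The last two parts are the
    lower bound for [n] arbitrary functionals and the upper bound for at most [2n] nodes. *)
Lemma finite_comparison (n : nat) (G0 : list Zvec) (t : R) :
  (1 <= n)%coq_nat -> List.NoDup G0 -> length G0 = n.+1 -> List.incl G0 G ->
  (forall k, List.In k G0 -> (t <= / (w k ^ 2))%coqR) ->
  exists T : R, (0 <= T)%coqR /\ (t <= T ^ 2)%coqR /\
   (forall l : nat -> Zvec -> Coquelicot.Complex.C, exists (j : nat -> nat) (c : Coef),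
      (forall i, (i < d)%coq_nat -> (j i < Q)%coq_nat) /\
      (forall k, ~ List.In k G -> c k = RtoC 0) /\
      (forall i, (i < n)%coq_nat -> csum G (fun k => Cmult (c k) (l i k)) = RtoC 0) /\
      (rsum G (fun k => Cmod (c k) ^ 2 * w k ^ 2) <= 1)%coqR /\
      (T <= Cmod (trigpoly c (gridpt Q j)))%coqR) /\
   (exists (N : nat) (X : nat -> nat -> nat), (N <= Nat.mul 2 n)%coq_nat /\
      (forall a i, (i < d)%coq_nat -> (X a i < Q)%coq_nat) /\
      forall c j, (forall i, (i < d)%coq_nat -> (j i < Q)%coq_nat) ->
        (rsum G (fun k => Cmod (c k) ^ 2 * w k ^ 2) <= 1)%coqR ->
        (Cmod (trigpoly c (gridpt Q j)) <=
           8 * T + rsum (List.seq 0 N) (fun a => Cmod (trigpoly c (gridpt Q (X a)))))%coqR).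
Proof.
move=> /ssrnat.leP n0 nd0 len0 inc0 tG0.
have ng : (n < g)%N.
  rewrite /g sizeE -len0; apply/ssrnat.leP; exact: List.NoDup_incl_length.
pose lam i := s i ^+ 2.
have lamr i : lam i \is Num.real by rewrite ger0_real // exprn_ge0 // ltW.
have [F [th [cF [l0 l0F thE] thF Fth]]] := top_set lamr ng.
have th0 : 0 <= th by rewrite thE exprn_ge0 // ltW.
pose T2 : R := \sum_(i | i \notin F) (w (kk i))^-1 ^+ 2.
have T2E : T2%:C = \sum_(i | i \notin F) lam i.
  by rewrite rmorph_sum; apply: eq_bigr => i _; rewrite rmorphXn.
have T20 : 0 <= T2 by apply: sumr_ge0 => i _; rewrite exprn_ge0 // invr_ge0 ltW.
pose T := Num.sqrt T2; have T0 : 0 <= T by apply: sqrtr_ge0.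
have TT : T ^+ 2 = T2 by rewrite sqr_sqrtr.
pose y0 : 'I_q := enum_rank [ffun=> Ordinal Q0].
exists T; split; first exact/RleP.
split.
  (* Pigeonhole: [G0] has [n + 1] frequencies and [F] only [n], so one of them contributes to the
     tail. *)
  have [k [kG0 kF]] : exists k, List.In k G0 /\ ~ List.In k [seq kk i | i <- enum F].
    apply: Classical_Prop.NNPP => no.
    have : List.incl G0 [seq kk i | i <- enum F].
      by move=> k kG; apply: Classical_Prop.NNPP => h; apply: no; exists k.
    move/(List.NoDup_incl_length nd0)/ssrnat.leP.
    by rewrite len0 -sizeE size_map -cardE cF ltnn.
  have [i ik] := In_nth_ord k0 (inc0 _ kG0).
  have iF : i \notin F.
    apply/negP => iF; apply: kF; rewrite -ik -/(kk i).
    apply: List.in_map; have : i \in enum F by rewrite mem_enum.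
    by elim: (enum F) => //= a r IH; rewrite inE => /orP[/eqP->|/IH]; [left|right].
  apply: Rle_trans (tG0 _ kG0) _; apply/RleP.
  rewrite !RpowE TT RinvE -ik -/(kk i) -exprVn /T2 (bigD1 i) //= lerDl.
  by apply: sumr_ge0 => j _; rewrite exprn_ge0 // invr_ge0 ltW.
split.
  (* In the coordinates [b k = c k * w k] each functional picks up the factor [s k]. *)
  move=> l; pose U : 'M[R[i]]_(n, g) := \matrix_(i, k) (s k * toC (l i (kk k))).
  have [y [b [Ub b1 hb]]] := kernel_lower_bound s_gt0 e_orth y0 U cF th0 thF Fth.
  pose f i : Coquelicot.Complex.C := (complex.Re (s i * b i), complex.Im (s i * b i)).
  have toCf i : toC (f i) = s i * b i by rewrite /toC /f /=; case: (_ * _).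
  have [c [cG c0]] := @extend_by_zero G k0 f (proj1 GP).
  have cE i : toC (c (kk i)) * (w (kk i))%:C = b i.
    rewrite cG toCf mulrAC /s -rmorphM mulVf ?rmorph1 ?mul1r //.
    by rewrite gt_eqF.
  exists (node y), c; split; first by move=> i /ssrnat.ltP id; apply/ssrnat.ltP/node_lt.
  split; first exact: c0.
  split.
    move=> i /ssrnat.ltP ilt; apply: toC_inj; rewrite csum_big (big_nth k0) big_mkord.
    have := congr1 (fun M : 'M_(_, _) => M (Ordinal ilt) 0) Ub.
    rewrite mxE [X in _ = X -> _]mxE => ub; apply: etrans ub.
    by apply: eq_bigr => k _; rewrite toCM cG toCf !mxE mulrAC.
  split.
    by apply/RleP; rewrite -lecR energyE; under eq_bigr do rewrite cE.
  apply/RleP; rewrite -(ler_sqr (x := T)) ?nnegrE //; last by apply/RleP/Cmod_ge_0.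
  rewrite TT -lecR T2E rmorphXn /= -toC_norm trigpolyE.
  by under [X in _ <= `|X| ^+ 2]eq_bigr do rewrite cE.
have [||N [X [N2 hX]]] := exists_sampling s_gt0 e_norm e_orth y0 (F := F) (m := n).
- by rewrite n0 ltnW.
- by rewrite cF.
(* Indices beyond [N] receive the default node [y0], so that every [Xn a] is a grid point. *)
pose Xn (a : nat) := node (if insub a is Some a' then X a' else y0).
exists N, Xn; split; first by apply/ssrnat.leP; rewrite -[Nat.mul 2 n]/(2 * n)%N mul2n.
split; first by move=> a i /ssrnat.ltP id; apply/ssrnat.ltP/node_lt.
move=> c j jQ c1.
have [y yj] : exists y, forall i, (i < d)%N -> node y i = j i.
  by apply: node_onto => i /ssrnat.ltP id; apply/ssrnat.ltP/jQ.
have -> : trigpoly c (gridpt Q j) = trigpoly c (gridpt Q (node y)).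
  rewrite /trigpoly; congr csum.
  apply: FunctionalExtensionality.functional_extensionality => k.
  congr (Cmult _ (cis2pi _)); rewrite !dot_big; apply: eq_bigr => i _.
  by rewrite /gridpt yj.
apply/RleP; rewrite -lecR -toC_norm trigpolyE.
apply: le_trans (hX y _ _) _; first by rewrite -energyE lecR; apply/RleP.
rewrite RplusE rmorphD lerD //.
  (* The constant [8] of the statement is the root of [64]. *)
  have -> : 64 * \sum_(k | k \notin F) s k ^+ 2 = ((8 * T)%:C) ^+ 2.
    rewrite -rmorphXn /= exprMn TT rmorphM -T2E; congr (_ * _).
    by rewrite -natrX rmorph_nat.
  rewrite sqrCK; last by rewrite lecR mulr_ge0.
  rewrite RmultE lecR; have -> // : 8%coqR = 8%:R :> R.
  rewrite -INRE /=; Lra.lra.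
rewrite rsum_big seq_iota -[X in iota 0 X](subn0 N) -/(index_iota 0 N) big_mkord rmorph_sum.
apply: ler_sum => i _ /=; rewrite -toC_norm -trigpolyE /Xn.
by rewrite valK.
Qed.

End Transport.

End FiniteDimension.

Import FiniteDimension.

(** * Unconditional sums *)

Section FiniteSums.
Context {A : Type}.
Implicit Types (l : list A) (a b : A -> R).

Lemma rsum_app l1 l2 a : rsum (l1 ++ l2) a = rsum l1 a + rsum l2 a.
Proof. induction l1 as [|x l1 IH]; simpl; [lra|rewrite IH; lra]. Qed.

Lemma rsum_perm l1 l2 a : Permutation l1 l2 -> rsum l1 a = rsum l2 a.
Proof. induction 1; simpl; lra. Qed.

Lemma rsum_le l a b : (forall k, In k l -> a k <= b k) -> rsum l a <= rsum l b.
Proof.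
induction l as [|x l IH]; intros H; simpl; [lra|].
pose proof (H x (or_introl eq_refl)).
enough (rsum l a <= rsum l b) by lra.
apply IH; intros k Hk; apply H; now right.
Qed.

Lemma rsum_ext l a b : (forall k, In k l -> a k = b k) -> rsum l a = rsum l b.
Proof.
intros H; apply Rle_antisym; apply rsum_le; intros k Hk; rewrite (H k Hk); lra.
Qed.

Lemma rsum_plus l a b : rsum l (fun k => a k + b k) = rsum l a + rsum l b.
Proof. induction l as [|x l IH]; simpl; [lra|rewrite IH; lra]. Qed.

Lemma rsum_scal l c a : rsum l (fun k => c * a k) = c * rsum l a.
Proof. induction l as [|x l IH]; simpl; [lra|rewrite IH; lra]. Qed.

Lemma rsum_const l c : rsum l (fun _ => c) = INR (length l) * c.
Proof.
induction l as [|x l IH]; [simpl; lra|].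
cbn [length rsum fold_right]; unfold rsum in IH; rewrite IH, S_INR; lra.
Qed.

Lemma rsum_nonneg l a : (forall k, In k l -> 0 <= a k) -> 0 <= rsum l a.
Proof.
intros H; apply Rle_trans with (rsum l (fun _ => 0)); [rewrite rsum_const; lra|].
now apply rsum_le.
Qed.

Lemma rsum_In_le l a k : (forall k, In k l -> 0 <= a k) -> In k l -> a k <= rsum l a.
Proof.
intros H Hk; destruct (in_split _ _ Hk) as [l1 [l2 ->]].
rewrite rsum_app; simpl.
assert (0 <= rsum l1 a) by (apply rsum_nonneg; intros; apply H; rewrite in_app_iff; tauto).
assert (0 <= rsum l2 a).
{ apply rsum_nonneg; intros; apply H; rewrite in_app_iff; simpl; tauto. }
lra.
Qed.

Lemma incl_perm l0 l : NoDup l0 -> incl l0 l -> exists r, Permutation l (l0 ++ r).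
Proof.
revert l; induction l0 as [|x l0 IH]; intros l Hnd Hincl; [now exists l|].
apply NoDup_cons_iff in Hnd as [Hx Hnd].
destruct (in_split x l (Hincl x (or_introl eq_refl))) as [l1 [l2 ->]].
destruct (IH (l1 ++ l2) Hnd) as [r Hr].
{ intros y Hy; assert (In y (l1 ++ x :: l2)) as Hi by (apply Hincl; now right).
  rewrite in_app_iff in *; simpl in Hi; destruct Hi as [?|[<-|?]]; tauto. }
exists r; rewrite <- Permutation_middle; now apply perm_skip.
Qed.

Lemma csum_app l1 l2 (a : A -> C) : csum (l1 ++ l2) a = Cplus (csum l1 a) (csum l2 a).
Proof. induction l1 as [|x l1 IH]; simpl; [ring|rewrite IH; ring]. Qed.

Lemma csum_perm l1 l2 (a : A -> C) : Permutation l1 l2 -> csum l1 a = csum l2 a.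
Proof. induction 1; simpl; try congruence; ring. Qed.

Lemma csum_lin l c (a b : A -> C) :
  csum l (fun k => Cplus (Cmult c (a k)) (b k)) = Cplus (Cmult c (csum l a)) (csum l b).
Proof. induction l as [|x l IH]; simpl; [ring|rewrite IH; ring]. Qed.

Lemma csum_RtoC l a : csum l (fun k => RtoC (a k)) = RtoC (rsum l a).
Proof. induction l as [|x l IH]; simpl; [easy|rewrite IH; now rewrite RtoC_plus]. Qed.

Lemma Cmod_csum l (a : A -> C) : Cmod (csum l a) <= rsum l (fun k => Cmod (a k)).
Proof.
induction l as [|x l IH]; simpl; [rewrite Cmod_0; lra|].
eapply Rle_trans; [apply Cmod_triangle|lra].
Qed.

End FiniteSums.

Lemma Zvec_eq_dec (k l : Zvec) : {k = l} + {k <> l}.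
Proof. apply excluded_middle_informative. Qed.

Lemma fin_index_union d l1 l2 : fin_index d l1 -> fin_index d l2 ->
  exists l, fin_index d l /\ incl l1 l /\ incl l2 l.
Proof.
intros [_ F1] [_ F2]; exists (nodup Zvec_eq_dec (l1 ++ l2)); split; [split|].
- apply NoDup_nodup.
- rewrite Forall_forall in *; intros k Hk; apply nodup_In, in_app_iff in Hk.
  destruct Hk; auto.
- split; intros k Hk; apply nodup_In, in_app_iff; auto.
Qed.

Lemma fin_index_diff d l0 l : fin_index d l0 -> fin_index d l -> incl l0 l ->
  exists r, Permutation l (l0 ++ r) /\ fin_index d r /\ forall k, In k r -> ~ In k l0.
Proof.
intros [N0 F0] [N F] Hi; destruct (incl_perm l0 l N0 Hi) as [r Hr]; exists r.
pose proof (Permutation_NoDup Hr N) as ND.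
split; [exact Hr|split; [split|]].
- now apply NoDup_app_remove_l in ND.
- rewrite Forall_forall in *; intros k Hk; apply F.
  apply (Permutation_in _ (Permutation_sym Hr)), in_app_iff; auto.
- intros k Hk Hk0; destruct (in_split _ _ Hk) as [r1 [r2 ->]].
  rewrite app_assoc in ND; apply NoDup_remove_2 in ND.
  apply ND; rewrite !in_app_iff; auto.
Qed.

Section Summability.
Variable d : nat.

Lemma has_sum_unique a u v : has_sum d a u -> has_sum d a v -> u = v.
Proof.
intros Hu Hv; apply NNPP; intros Huv.
assert (0 < Cmod (Cminus u v)) as Hp.
{ apply Cmod_gt_0; intros E; apply Huv.
  replace u with (Cplus (Cminus u v) v) by ring; rewrite E; ring. }
destruct (Hu (Cmod (Cminus u v) / 2)) as [l1 [F1 H1]]; [lra|].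
destruct (Hv (Cmod (Cminus u v) / 2)) as [l2 [F2 H2]]; [lra|].
destruct (fin_index_union d l1 l2 F1 F2) as [l [Fl [I1 I2]]].
specialize (H1 l Fl I1); specialize (H2 l Fl I2).
assert (Cmod (Cminus u v) <= Cmod (Cminus (csum l a) v) + Cmod (Cminus (csum l a) u)); [|lra].
replace (Cminus u v) with (Cplus (Cminus (csum l a) v) (Copp (Cminus (csum l a) u))) by ring.
eapply Rle_trans; [apply Cmod_triangle|rewrite Cmod_opp; lra].
Qed.

Lemma has_sum_ext a b v : (forall k, a k = b k) -> has_sum d a v -> has_sum d b v.
Proof. intros E; replace b with a; [easy|now apply functional_extensionality]. Qed.

Lemma has_sum_lin c a b u v : has_sum d a u -> has_sum d b v ->
  has_sum d (fun k => Cplus (Cmult c (a k)) (b k)) (Cplus (Cmult c u) v).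
Proof.
intros Hu Hv eps He.
assert (0 < Cmod c + 1) as Hc by (pose proof (Cmod_ge_0 c); lra).
destruct (Hu (eps / 2 / (Cmod c + 1))) as [l1 [F1 H1]].
{ apply Rdiv_lt_0_compat; lra. }
destruct (Hv (eps / 2)) as [l2 [F2 H2]]; [lra|].
destruct (fin_index_union d l1 l2 F1 F2) as [l0 [F0 [I1 I2]]].
exists l0; split; [exact F0|intros l Fl Il].
specialize (H1 l Fl (incl_tran I1 Il)); specialize (H2 l Fl (incl_tran I2 Il)).
rewrite csum_lin.
replace (Cminus (Cplus (Cmult c (csum l a)) (csum l b)) (Cplus (Cmult c u) v))
  with (Cplus (Cmult c (Cminus (csum l a) u)) (Cminus (csum l b) v)) by ring.
eapply Rle_lt_trans; [apply Cmod_triangle|rewrite Cmod_mult].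
assert (Cmod c * Cmod (Cminus (csum l a) u) <= eps / 2); [|lra].
apply Rle_trans with ((Cmod c + 1) * (eps / 2 / (Cmod c + 1))); [|right; field; lra].
apply Rmult_le_compat; try apply Cmod_ge_0; lra.
Qed.

(** The partial sums form a bounded increasing net, which converges to its supremum. *)
Lemma has_sum_nonneg a M : (forall k, 0 <= a k) ->
  (forall l, fin_index d l -> rsum l a <= M) ->
  exists v, has_sum d (fun k => RtoC (a k)) (RtoC v).
Proof.
intros Ha HM.
destruct (completeness (fun r => exists l, fin_index d l /\ r = rsum l a)) as [v [Hub Hlub]].
- exists M; intros r [l [Fl ->]]; auto.
- exists 0, nil; split; [split; [apply NoDup_nil|apply Forall_nil]|reflexivity].
- exists v; intros eps He.
  assert (exists l0, fin_index d l0 /\ v - eps < rsum l0 a) as [l0 [F0 H0]].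
  { apply NNPP; intros no.
    assert (v <= v - eps); [|lra].
    apply Hlub; intros r [l [Fl ->]].
    apply Rnot_lt_le; intros Hlt; apply no; now exists l. }
  exists l0; split; [exact F0|intros l Fl Il].
  rewrite csum_RtoC, <- RtoC_minus, Cmod_R.
  assert (rsum l a <= v) by (apply Hub; now exists l).
  destruct (fin_index_diff d l0 l F0 Fl Il) as [r [Hr _]].
  rewrite (rsum_perm _ _ a Hr), rsum_app in *.
  assert (0 <= rsum r a) by (apply rsum_nonneg; auto).
  apply Rabs_def1; lra.
Qed.

(** Adding [|a|] to the real and to the imaginary part gives nonnegative families with sums at most
    [2 M]; the sum of [|a|] is subtracted afterwards. *)
Lemma has_sum_abs a M : (forall l, fin_index d l -> rsum l (fun k => Cmod (a k)) <= M) ->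
  exists v, has_sum d a v.
Proof.
intros HM.
destruct (has_sum_nonneg (fun k => Cmod (a k)) M) as [u Hu]; auto using Cmod_ge_0.
assert (forall k, Rabs (fst (a k)) <= Cmod (a k) /\ Rabs (snd (a k)) <= Cmod (a k)) as Hc.
{ intros k; pose proof (Rmax_Cmod (a k)).
  pose proof (Rmax_l (Rabs (fst (a k))) (Rabs (snd (a k)))).
  pose proof (Rmax_r (Rabs (fst (a k))) (Rabs (snd (a k)))). lra. }
assert (forall p : Zvec -> R, (forall k, Rabs (p k) <= Cmod (a k)) ->
  exists v, has_sum d (fun k => RtoC (Cmod (a k) + p k)) (RtoC v)) as Hp.
{ intros p Hp; apply has_sum_nonneg with (M := 2 * M).
  - intros k; specialize (Hp k); apply Rabs_le_between in Hp; lra.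
  - intros l Fl; specialize (HM l Fl).
    apply Rle_trans with (rsum l (fun k => 2 * Cmod (a k))); [|rewrite rsum_scal; lra].
    apply rsum_le; intros k _; specialize (Hp k); apply Rabs_le_between in Hp; lra. }
destruct (Hp (fun k => fst (a k))) as [x Hx]; [apply Hc|].
destruct (Hp (fun k => snd (a k))) as [y Hy]; [apply Hc|].
eexists.
eapply has_sum_ext;
  [|exact (has_sum_lin Ci _ _ _ _ (has_sum_lin (RtoC (-1)) _ _ _ _ Hu Hy)
        (has_sum_lin (RtoC (-1)) _ _ _ _ Hu Hx))].
intros k; apply injective_projections; cbn; ring.
Qed.

Lemma has_sum_bound a v l0 z B : fin_index d l0 -> has_sum d a v ->
  (forall l, fin_index d l -> incl l0 l -> Cmod (Cminus (csum l a) z) <= B) ->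
  Cmod (Cminus v z) <= B.
Proof.
intros F0 Hv HB; apply Rnot_lt_le; intros Hlt.
destruct (Hv (Cmod (Cminus v z) - B)) as [l1 [F1 H1]]; [lra|].
destruct (fin_index_union d l0 l1 F0 F1) as [l [Fl [I0 I1]]].
specialize (HB l Fl I0); specialize (H1 l Fl I1).
assert (Cmod (Cminus v z) <= Cmod (Cminus (csum l a) z) + Cmod (Cminus (csum l a) v)); [|lra].
replace (Cminus v z) with (Cplus (Cminus (csum l a) z) (Copp (Cminus (csum l a) v))) by ring.
eapply Rle_trans; [apply Cmod_triangle|rewrite Cmod_opp; lra].
Qed.

End Summability.

(** * Point evaluation on the weighted space *)

Lemma Cmod_cis2pi t : Cmod (cis2pi t) = 1.
Proof. exact (Cmod_cis t). Qed.

Section HilbertSpace.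
Variables (d : nat) (w : Weight).
Hypothesis Hw : weight_ok w.

Lemma weight_pos k : supp d k -> 0 < w d k.
Proof. apply (Hw d). Qed.

Lemma fin_index_supp l k : fin_index d l -> In k l -> supp d k.
Proof. intros [_ F]; rewrite Forall_forall in F; auto. Qed.

(* AM-GM: [2 |c| <= eta |c|^2 w^2 + 1 / (w^2 eta)] *)
Lemma coef_sum_bound c l eta : 0 < eta -> fin_index d l ->
  2 * rsum l (fun k => Cmod (c k)) <= eta * wsum d w c l + rsum l (fun k => / w d k ^ 2) / eta.
Proof.
intros He Fl; unfold wsum.
unfold Rdiv; rewrite (Rmult_comm (rsum l _) (/ eta)), <- !rsum_scal, <- rsum_plus.
apply rsum_le; intros k Hk; pose proof (weight_pos k (fin_index_supp l k Fl Hk)) as Hp.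
assert (0 <= (eta * w d k * Cmod (c k) - / w d k) ^ 2 / eta) as Hs.
{ apply Rmult_le_pos; [apply pow2_ge_0|left; now apply Rinv_0_lt_compat]. }
apply Rminus_le; replace (2 * Cmod (c k) - _) with (- ((eta * w d k * Cmod (c k) - / w d k) ^ 2 / eta));
 [lra|field; lra].
Qed.

Definition character_term (f : Coef) (x : nat -> R) : Zvec -> C :=
  fun k => Cmult (f k) (cis2pi (dot d k x)).

Lemma Cmod_character_term f x k : Cmod (character_term f x k) = Cmod (f k).
Proof. unfold character_term; rewrite Cmod_mult, Cmod_cis2pi; ring. Qed.

(** The Fourier coefficients are absolutely summable by [coef_sum_bound] with [eta = 1], so the
    choice operator in [fval] returns a genuine sum. *)
Lemma fval_spec f x : inH d w f -> has_sum d (character_term f x) (fval d f x).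
Proof.
intros [_ [M HM]]; unfold fval; apply epsilon_spec.
destruct (Hw d) as [_ [W HW]].
apply (has_sum_abs d _ ((M + W) / 2)); intros l Fl.
rewrite (rsum_ext l _ (fun k => Cmod (f k))) by (intros; apply Cmod_character_term).
pose proof (coef_sum_bound f l 1 Rlt_0_1 Fl); specialize (HM l Fl); specialize (HW l Fl).
lra.
Qed.

Lemma fval_unique f x v : inH d w f -> has_sum d (character_term f x) v -> fval d f x = v.
Proof. intros Hf Hv; eapply has_sum_unique; [now apply fval_spec|exact Hv]. Qed.

Lemma Cmod_lin_sq c a b : Cmod (Cplus (Cmult c a) b) ^ 2 <= 2 * Cmod c ^ 2 * Cmod a ^ 2 + 2 * Cmod b ^ 2.
Proof.
assert (Cmod (Cplus (Cmult c a) b) <= Cmod c * Cmod a + Cmod b) as H.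
{ rewrite <- Cmod_mult; apply Cmod_triangle. }
pose proof (Cmod_ge_0 (Cplus (Cmult c a) b)).
apply Rle_trans with ((Cmod c * Cmod a + Cmod b) ^ 2).
- apply pow_incr; lra.
- pose proof (pow2_ge_0 (Cmod c * Cmod a - Cmod b)); nra.
Qed.

Lemma wsum_lin c f g l :
  wsum d w (fun k => Cplus (Cmult c (f k)) (g k)) l <= 2 * Cmod c ^ 2 * wsum d w f l + 2 * wsum d w g l.
Proof.
unfold wsum; rewrite <- !rsum_scal, <- rsum_plus; apply rsum_le; intros k _.
pose proof (Cmod_lin_sq c (f k) (g k)); pose proof (pow2_ge_0 (w d k)); nra.
Qed.

Lemma inH_lin c f g : inH d w f -> inH d w g -> inH d w (fun k => Cplus (Cmult c (f k)) (g k)).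
Proof.
intros [Sf [M HM]] [Sg [N HN]]; split.
- intros k Hk; rewrite Sf, Sg by exact Hk; ring.
- exists (2 * Cmod c ^ 2 * M + 2 * N); intros l Fl.
  eapply Rle_trans; [apply wsum_lin|].
  pose proof (pow2_ge_0 (Cmod c)); specialize (HM l Fl); specialize (HN l Fl); nra.
Qed.

Lemma fval_lin c f g x : inH d w f -> inH d w g ->
  fval d (fun k => Cplus (Cmult c (f k)) (g k)) x = Cplus (Cmult c (fval d f x)) (fval d g x).
Proof.
intros Hf Hg; apply fval_unique; [now apply inH_lin|].
eapply has_sum_ext; [|apply (has_sum_lin d c); apply fval_spec; eassumption].
intros k; unfold character_term; ring.
Qed.

Lemma inH_zero : inH d w (fun _ => RtoC 0).
Proof.
split; [easy|exists 0; intros l _; unfold wsum].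
rewrite (rsum_ext l _ (fun _ => 0)) by (intros; rewrite Cmod_0; ring).
rewrite rsum_const; lra.
Qed.

(** This is [(f - g) / 2], which stays in the unit ball and vanishes where [f] and [g] agree. The
    shape [c a + b] with [c = -1] is the one that [Cmod_lin_sq] expects. *)
Definition half_diff (f g : Coef) : Coef :=
  fun k => Cplus (Cmult (RtoC (-1)) (Cmult (RtoC (/ 2)) (g k))) (Cmult (RtoC (/ 2)) (f k)).

Lemma half_diff_lin f g : half_diff f g = fun k =>
  Cplus (Cmult (RtoC (- / 2)) (g k)) (Cplus (Cmult (RtoC (/ 2)) (f k)) (RtoC 0)).
Proof.
apply functional_extensionality; intros k; unfold half_diff.
apply injective_projections; cbn; field.
Qed.

Lemma inH_half_diff f g : inH d w f -> inH d w g -> inH d w (half_diff f g).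
Proof.
intros Hf Hg; rewrite half_diff_lin; apply inH_lin; [easy|].
apply (inH_lin (RtoC (/ 2)) f (fun _ => RtoC 0)); [easy|apply inH_zero].
Qed.

Lemma fval_zero x : fval d (fun _ => RtoC 0) x = RtoC 0.
Proof.
apply fval_unique; [apply inH_zero|intros eps He; exists nil].
split; [split; [apply NoDup_nil|apply Forall_nil]|intros l _ _].
replace (Cminus _ _) with (RtoC 0); [rewrite Cmod_0; lra|].
enough (csum l (character_term (fun _ => RtoC 0) x) = RtoC 0) as -> by ring.
induction l as [|k l IH]; simpl; [easy|rewrite IH; unfold character_term; ring].
Qed.

Lemma fval_half_diff f g x : inH d w f -> inH d w g ->
  fval d (half_diff f g) x = Cmult (RtoC (/ 2)) (Cminus (fval d f x) (fval d g x)).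
Proof.
intros Hf Hg; rewrite half_diff_lin.
rewrite (fval_lin _ g (fun k => Cplus (Cmult (RtoC (/ 2)) (f k)) (RtoC 0))); [|easy|].
- rewrite (fval_lin _ f (fun _ => RtoC 0)); [|easy|apply inH_zero].
  rewrite fval_zero; apply injective_projections; cbn; field.
- apply (inH_lin (RtoC (/ 2)) f (fun _ => RtoC 0)); [easy|apply inH_zero].
Qed.

Lemma unit_ball_half_diff f g : unit_ball d w f -> unit_ball d w g -> unit_ball d w (half_diff f g).
Proof.
intros Hf Hg l Fl; specialize (Hf l Fl); specialize (Hg l Fl).
apply Rle_trans with (/ 2 * wsum d w f l + / 2 * wsum d w g l); [|lra].
unfold wsum; rewrite <- !rsum_scal, <- rsum_plus; apply rsum_le; intros k _.
unfold half_diff.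
pose proof (Cmod_lin_sq (RtoC (-1)) (Cmult (RtoC (/ 2)) (g k)) (Cmult (RtoC (/ 2)) (f k))) as H.
rewrite !Cmod_mult, !Cmod_R, (Rabs_left (-1)), (Rabs_pos_eq (/ 2)) in H by lra.
pose proof (pow2_ge_0 (w d k)); nra.
Qed.

Lemma fval_bound W f x : inH d w f -> unit_ball d w f ->
  (forall l, fin_index d l -> rsum l (fun k => / w d k ^ 2) <= W) ->
  Cmod (fval d f x) <= (1 + W) / 2.
Proof.
intros Hf Bf HW.
replace (fval d f x) with (Cminus (fval d f x) (RtoC 0)) by ring.
apply (has_sum_bound d (character_term f x) _ nil).
- split; [apply NoDup_nil|apply Forall_nil].
- now apply fval_spec.
- intros l Fl _; replace (Cminus _ (RtoC 0)) with (csum l (character_term f x)) by ring.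
  eapply Rle_trans; [apply Cmod_csum|].
  rewrite (rsum_ext l _ (fun k => Cmod (f k))) by (intros; apply Cmod_character_term).
  pose proof (coef_sum_bound f l 1 Rlt_0_1 Fl); specialize (Bf l Fl); specialize (HW l Fl); lra.
Qed.

(** Outside [G] the weights sum to at most [eta^2], so [coef_sum_bound] at this [eta] bounds twice
    the remaining coefficient sum by [eta + eta]. *)
Lemma fval_truncation G eta f x : 0 < eta -> fin_index d G ->
  (forall l, fin_index d l -> (forall k, In k l -> ~ In k G) ->
     rsum l (fun k => / w d k ^ 2) <= eta ^ 2) ->
  inH d w f -> unit_ball d w f ->
  Cmod (Cminus (fval d f x) (csum G (character_term f x))) <= eta.
Proof.
intros He FG HG Hf Bf.
apply (has_sum_bound d (character_term f x) _ G); [easy|now apply fval_spec|].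
intros l Fl Il; destruct (fin_index_diff d G l FG Fl Il) as [r [Hr [Fr Dr]]].
rewrite (csum_perm _ _ _ Hr), csum_app.
replace (Cminus (Cplus _ _) _) with (csum r (character_term f x)) by ring.
eapply Rle_trans; [apply Cmod_csum|].
rewrite (rsum_ext r _ (fun k => Cmod (f k))) by (intros; apply Cmod_character_term).
pose proof (coef_sum_bound f r eta He Fr) as H; specialize (Bf r Fr); specialize (HG r Fr Dr).
assert (rsum r (fun k => / w d k ^ 2) / eta <= eta).
{ apply Rmult_le_reg_r with eta; [easy|].
  unfold Rdiv; rewrite Rmult_assoc, Rinv_l by lra; lra. }
nra.
Qed.

(** [G] contains a list whose sum is within [eta] of the supremum, so a disjoint list can add at
    most [eta]. *)
Lemma small_tail G0 eta : 0 < eta -> fin_index d G0 -> exists G, fin_index d G /\ incl G0 G /\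
  forall l, fin_index d l -> (forall k, In k l -> ~ In k G) ->
     rsum l (fun k => / w d k ^ 2) <= eta.
Proof.
intros He F0; destruct (Hw d) as [_ [W HW]].
destruct (completeness (fun r => exists l, fin_index d l /\ r = rsum l (fun k => / w d k ^ 2)))
  as [S [Hub Hlub]].
- exists W; intros r [l [Fl ->]]; auto.
- exists 0, nil; split; [split; [apply NoDup_nil|apply Forall_nil]|reflexivity].
- assert (exists l1, fin_index d l1 /\ S - eta < rsum l1 (fun k => / w d k ^ 2)) as [l1 [F1 H1]].
  { apply NNPP; intros no; assert (S <= S - eta); [|lra].
    apply Hlub; intros r [l [Fl ->]].
    apply Rnot_lt_le; intros Hlt; apply no; now exists l. }
  destruct (fin_index_union d G0 l1 F0 F1) as [G [FG [I0 I1]]].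
  exists G; split; [easy|split; [easy|intros l Fl Dl]].
  assert (fin_index d (G ++ l)) as FGl.
  { destruct FG as [NG AG], Fl as [Nl Al]; split; [|now apply Forall_app].
    apply NoDup_app; auto; intros k HkG Hkl; now apply (Dl k). }
  assert (rsum (G ++ l) (fun k => / w d k ^ 2) <= S) as HS by (apply Hub; now exists (G ++ l)).
  rewrite rsum_app in HS.
  destruct (fin_index_diff d l1 G F1 FG I1) as [r [Hr [Fr _]]].
  rewrite (rsum_perm _ _ _ Hr), rsum_app in HS.
  assert (0 <= rsum r (fun k => / w d k ^ 2)); [|lra].
  apply rsum_nonneg; intros k Hk; left; apply Rinv_0_lt_compat, pow_lt, weight_pos.
  exact (fin_index_supp r k Fr Hk).
Qed.

End HilbertSpace.

(** * Lipschitz bounds for characters and rounding to the grid *)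

Lemma sin_lipschitz a b : Rabs (sin a - sin b) <= Rabs (a - b).
Proof.
assert (forall t, 0 < t -> Rabs (sin t) <= t) as Hpos.
{ intros t Ht; apply Rabs_le; split; [|left; now apply sin_lt_x].
  destruct (Rle_lt_dec t PI) as [H|H].
  - assert (0 <= sin t) by (apply sin_ge_0; lra); lra.
  - pose proof (SIN_bound t); pose proof PI2_1; unfold PI2 in *; lra. }
assert (forall t, Rabs (sin t) <= Rabs t) as Hs.
{ intros t; destruct (Rtotal_order t 0) as [H|[->|H]].
  - rewrite <- (Rabs_Ropp (sin t)), <- sin_neg, (Rabs_left t) by easy; apply Hpos; lra.
  - rewrite sin_0, Rabs_R0; lra.
  - rewrite (Rabs_pos_eq t) by lra; now apply Hpos. }
rewrite form4, !Rabs_mult, (Rabs_pos_eq 2) by lra.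
specialize (Hs ((a - b) / 2)); unfold Rdiv in Hs at 2.
rewrite Rabs_mult, (Rabs_pos_eq (/ 2)) in Hs by lra.
assert (Rabs (cos ((a + b) / 2)) <= 1) by (apply Rabs_le, COS_bound).
pose proof (Rabs_pos (sin ((a - b) / 2))); pose proof (Rabs_pos (cos ((a + b) / 2))).
nra.
Qed.

Lemma cos_lipschitz a b : Rabs (cos a - cos b) <= Rabs (a - b).
Proof.
rewrite !cos_sin; replace (a - b) with ((PI / 2 + a) - (PI / 2 + b)) by ring.
apply sin_lipschitz.
Qed.

Lemma cis2pi_lipschitz a b : Cmod (Cminus (cis2pi a) (cis2pi b)) <= 4 * PI * Rabs (a - b).
Proof.
pose proof PI_RGT_0.
assert (Rabs (2 * PI * a - 2 * PI * b) = 2 * PI * Rabs (a - b)) as E.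
{ rewrite <- Rmult_minus_distr_l, Rabs_mult, (Rabs_pos_eq (2 * PI)) by lra; ring. }
pose proof (sin_lipschitz (2 * PI * a) (2 * PI * b)) as Hs.
pose proof (cos_lipschitz (2 * PI * a) (2 * PI * b)) as Hc.
rewrite E in *.
replace (Cminus (cis2pi a) (cis2pi b)) with
  (Cplus (RtoC (cos (2 * PI * a) - cos (2 * PI * b)))
         (Cmult Ci (RtoC (sin (2 * PI * a) - sin (2 * PI * b))))).
- eapply Rle_trans; [apply Cmod_triangle|].
  rewrite Cmod_mult, !Cmod_R; replace (Cmod Ci) with 1; [lra|].
  unfold Cmod, Ci; cbn [fst snd]; replace (0 ^ 2 + 1 ^ 2) with 1 by ring; now rewrite sqrt_1.
- apply injective_projections; cbn; ring.
Qed.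

(** Rounding down, except at the right end: the grid has no node at [1], which goes to
    [(Q - 1) / Q], still within [1 / Q]. *)
Lemma nearest_grid Q m t : (1 <= Q)%nat -> (1 <= m)%nat -> 0 <= t <= INR m / INR Q ->
  exists j, (j < m)%nat /\ Rabs (t - INR j / INR Q) <= / INR Q.
Proof.
intros HQ; assert (0 < INR Q) as Q0 by (apply lt_0_INR; lia).
assert (0 < / INR Q) as iQ by now apply Rinv_0_lt_compat.
induction m as [|m IH]; intros Hm Ht; [lia|].
destruct (Rle_lt_dec (INR m / INR Q) t) as [H|H].
- exists m; split; [lia|]; rewrite S_INR in Ht; apply Rabs_le; unfold Rdiv in *; lra.
- destruct m as [|m].
  + exfalso; unfold Rdiv in H; cbn in H; lra.
  + destruct IH as [j [Hj Hd]]; [lia|lra|]; exists j; split; [lia|exact Hd].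
Qed.

Lemma grid_approx d Q x : (1 <= Q)%nat -> in_cube d x ->
  exists j : nat -> nat, (forall i, (i < d)%nat -> (j i < Q)%nat) /\
    forall i, (i < d)%nat -> Rabs (x i - gridpt Q j i) <= / INR Q.
Proof.
intros HQ Hx.
assert (forall i, exists j, (i < d)%nat -> (j < Q)%nat /\ Rabs (x i - INR j / INR Q) <= / INR Q) as H.
{ intros i; destruct (Nat.lt_ge_cases i d) as [Hi|Hi]; [|exists 0%nat; lia].
  destruct (nearest_grid Q Q (x i) HQ HQ) as [j Hj]; [|now exists j].
  unfold Rdiv; rewrite Rinv_r; [now apply Hx|apply not_0_INR; lia]. }
exists (fun i => proj1_sig (constructive_indefinite_description _ (H i))).
split; intros i Hi; unfold gridpt;
  destruct (constructive_indefinite_description _ (H i)) as [j Hj]; now apply Hj.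
Qed.

Lemma gridpt_in_cube d Q j : (forall i, (i < d)%nat -> (j i < Q)%nat) -> in_cube d (gridpt Q j).
Proof.
intros H i Hi; specialize (H i Hi); unfold gridpt.
assert (0 < INR Q) by (apply lt_0_INR; lia).
assert (INR (j i) <= INR Q) by (apply le_INR; lia).
pose proof (pos_INR (j i)); split; [apply Rmult_le_pos; [easy|]|].
- left; now apply Rinv_0_lt_compat.
- apply Rmult_le_reg_r with (INR Q); [easy|]; unfold Rdiv.
  rewrite Rmult_assoc, Rinv_l by lra; lra.
Qed.

Lemma dot_diff d k x y q : (forall i, (i < d)%nat -> Rabs (x i - y i) <= q) ->
  Rabs (dot d k x - dot d k y) <= rsum (seq 0 d) (fun i => Rabs (IZR (k i))) * q.
Proof.
intros H; unfold dot.
assert (forall l, (forall i, In i l -> (i < d)%nat) ->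
  Rabs (rsum l (fun i => IZR (k i) * x i) - rsum l (fun i => IZR (k i) * y i)) <=
  rsum l (fun i => Rabs (IZR (k i))) * q) as G.
- induction l as [|i l IH]; intros Hl; cbn; [rewrite Rminus_diag, Rabs_R0; lra|].
  fold (rsum l (fun i => IZR (k i) * x i)); fold (rsum l (fun i => IZR (k i) * y i)).
  fold (rsum l (fun i => Rabs (IZR (k i)))).
  assert (Rabs (x i - y i) <= q) as Hi by (apply H, Hl; now left).
  assert (forall j, In j l -> (j < d)%nat) as Hl' by (intros j Hj; apply Hl; now right).
  specialize (IH Hl').
  replace (_ - _) with (IZR (k i) * (x i - y i) +
    (rsum l (fun i => IZR (k i) * x i) - rsum l (fun i => IZR (k i) * y i))) by ring.
  eapply Rle_trans; [apply Rabs_triang|rewrite Rabs_mult].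
  pose proof (Rabs_pos (IZR (k i))); nra.
- apply G; intros i Hi; apply in_seq in Hi; lia.
Qed.

(** * Finitely supported coefficients, linear functionals and interpolation *)

Section FiniteSupport.
Variables (d : nat) (w : Weight).
Hypothesis Hw : weight_ok w.

Lemma rsum_support l G (a : Zvec -> R) : fin_index d l -> fin_index d G ->
  (forall k, 0 <= a k) -> (forall k, ~ In k G -> a k = 0) -> rsum l a <= rsum G a.
Proof.
intros Fl FG Ha H0.
destruct (fin_index_union d l G Fl FG) as [l' [Fl' [I1 I2]]].
destruct (fin_index_diff d l l' Fl Fl' I1) as [r1 [P1 _]].
destruct (fin_index_diff d G l' FG Fl' I2) as [r2 [P2 [_ D2]]].
assert (rsum l a + rsum r1 a = rsum G a + rsum r2 a) as E.
{ rewrite <- !rsum_app, <- (rsum_perm _ _ a P1); now apply rsum_perm. }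
assert (0 <= rsum r1 a) by (apply rsum_nonneg; auto).
assert (rsum r2 a <= rsum r2 (fun _ => 0)) as E2.
{ apply rsum_le; intros k Hk; rewrite H0; [lra|now apply D2]. }
rewrite rsum_const in E2; lra.
Qed.

Section Coefficients.
Variables (G : list Zvec) (c : Coef).
Hypothesis FG : fin_index d G.
Hypothesis c0 : forall k, ~ In k G -> c k = RtoC 0.

Lemma finite_wsum_le l : fin_index d l -> wsum d w c l <= wsum d w c G.
Proof.
intros Fl; apply rsum_support; auto.
- intros k; apply Rmult_le_pos; apply pow2_ge_0.
- intros k Hk; rewrite c0, Cmod_0 by easy; ring.
Qed.

Lemma finite_inH : inH d w c.
Proof.
split; [|exists (wsum d w c G); exact finite_wsum_le].
intros k Hk; apply c0; intros HkG; apply Hk.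
exact (fin_index_supp d G k FG HkG).
Qed.

Lemma finite_unit_ball : wsum d w c G <= 1 -> unit_ball d w c.
Proof. intros H l Fl; eapply Rle_trans; [now apply finite_wsum_le|exact H]. Qed.

Lemma finite_fval x : fval d c x = csum G (character_term d c x).
Proof.
apply (fval_unique d w Hw); [exact finite_inH|].
intros eps He; exists G; split; [exact FG|intros l Fl Il].
destruct (fin_index_diff d G l FG Fl Il) as [r [Hr [_ Dr]]].
rewrite (csum_perm _ _ _ Hr), csum_app.
replace (Cminus _ _) with (csum r (character_term d c x)) by ring.
eapply Rle_lt_trans; [apply Cmod_csum|].
rewrite (rsum_ext r _ (fun _ => 0)); [rewrite rsum_const; lra|].
intros k Hk; unfold character_term; rewrite c0 by now apply Dr.
rewrite Cmult_0_l; apply Cmod_0.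
Qed.

End Coefficients.

Definition delta (k : Zvec) : Coef :=
  fun v => if Zvec_eq_dec v k then RtoC 1 else RtoC 0.

Lemma delta_inH k : supp d k -> inH d w (delta k).
Proof.
intros Hk; apply finite_inH with (k :: nil).
- split; [apply NoDup_cons; [easy|apply NoDup_nil]|now apply Forall_cons].
- intros v Hv; unfold delta; destruct (Zvec_eq_dec v k) as [->|]; [|easy].
  exfalso; apply Hv; now left.
Qed.

Lemma lam_all_zero L : lam_all d w L -> L (fun _ => RtoC 0) = RtoC 0.
Proof.
intros [HL _]; specialize (HL _ _ (RtoC 1) (inH_zero d w) (inH_zero d w)); cbn in HL.
replace (fun _ : Zvec => Cplus (Cmult (RtoC 1) (RtoC 0)) (RtoC 0)) with (fun _ : Zvec => RtoC 0) in HL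
  by (apply functional_extensionality; intros; ring).
replace (L (fun _ => RtoC 0)) with
  (Cminus (Cplus (Cmult (RtoC 1) (L (fun _ => RtoC 0))) (L (fun _ => RtoC 0))) (L (fun _ => RtoC 0)))
  by ring.
rewrite <- HL; ring.
Qed.

(** Peeling off one frequency at a time. Linearity of [L] is available only inside the space, so
    each piece must be shown to lie there. *)
Lemma lam_all_csum L G c : lam_all d w L -> fin_index d G ->
  (forall k, ~ In k G -> c k = RtoC 0) -> L c = csum G (fun k => Cmult (c k) (L (delta k))).
Proof.
intros HL; revert c; induction G as [|k G IH]; intros c FG c0; cbn.
- rewrite <- (lam_all_zero L HL); f_equal.
  apply functional_extensionality; intros k; apply c0; easy.
- fold (csum G (fun k => Cmult (c k) (L (delta k)))).
  assert (fin_index d G /\ ~ In k G /\ supp d k) as [FG' [kG sk]].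
  { destruct FG as [N F]; apply NoDup_cons_iff in N; inversion F; unfold fin_index; tauto. }
  set (c' := fun v => if Zvec_eq_dec v k then RtoC 0 else c v).
  assert (forall v, ~ In v G -> c' v = RtoC 0) as c'0.
  { intros v Hv; unfold c'; destruct (Zvec_eq_dec v k) as [->|Hne]; [easy|].
    apply c0; intros [->|?]; easy. }
  assert (c = fun v => Cplus (Cmult (c k) (delta k v)) (c' v)) as E.
  { apply functional_extensionality; intros v; unfold delta, c'.
    destruct (Zvec_eq_dec v k) as [->|]; ring. }
  rewrite E at 1; rewrite (proj1 HL); [|now apply delta_inH|now apply finite_inH with G].
  f_equal; rewrite (IH c' FG' c'0).
  assert (forall l, ~ In k l -> csum l (fun v => Cmult (c' v) (L (delta v))) =
    csum l (fun v => Cmult (c v) (L (delta v)))) as Ec; [|now apply Ec].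
  induction l as [|v l IHl]; intros Hl; cbn; [easy|].
  unfold csum in IHl; rewrite IHl by (intros ?; apply Hl; now right); f_equal; f_equal.
  unfold c'; destruct (Zvec_eq_dec v k) as [->|]; [|easy]; exfalso; apply Hl; now left.
Qed.

(** Fooling argument: [c] and its negative have the same zero data, hence the same output [p], and
    the two errors add up to at least twice the modulus of the value of [c]. *)
Lemma alg_error_ge n Ls phi r G c x :
  (forall i, (i < n)%nat -> lam_all d w (Ls i)) -> alg_error d w n Ls phi = Finite r ->
  fin_index d G -> (forall k, ~ In k G -> c k = RtoC 0) -> wsum d w c G <= 1 ->
  (forall i, (i < n)%nat -> csum G (fun k => Cmult (c k) (Ls i (delta k))) = RtoC 0) ->
  in_cube d x -> Cmod (csum G (character_term d c x)) <= r.
Proof.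
intros HLs Hr FG c0 Bc Hker Hx; unfold alg_error in Hr.
match type of Hr with context [Lub_Rbar ?e] => set (E := e) in Hr end.
destruct (Lub_Rbar_correct E) as [Hub _]; rewrite Hr in Hub.
set (p := phi (map (fun _ => RtoC 0) (seq 0 n)) x).
assert (forall f, (forall k, ~ In k G -> f k = RtoC 0) -> wsum d w f G <= 1 ->
  (forall i, (i < n)%nat -> csum G (fun k => Cmult (f k) (Ls i (delta k))) = RtoC 0) ->
  Cmod (Cminus (csum G (character_term d f x)) p) <= r) as Hf.
{ intros f f0 Bf Hk; apply (Hub _); exists f, x; split; [|split; [|split; [easy|]]].
  - now apply finite_inH with G.
  - now apply finite_unit_ball with G.
  - rewrite (finite_fval G f FG f0); unfold p.
    replace (map (fun i => Ls i f) (seq 0 n)) with (map (fun _ : nat => RtoC 0) (seq 0 n));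
      [easy|apply map_ext_in].
    intros i Hi; apply in_seq in Hi.
    rewrite (lam_all_csum (Ls i) G f); [symmetry; apply Hk; lia|apply HLs; lia|easy|easy]. }
pose proof (Hf c c0 Bc Hker) as H1.
assert (forall a : Zvec -> C, csum G (fun k => Cmult (Copp (c k)) (a k)) =
   Copp (csum G (fun k => Cmult (c k) (a k)))) as Eopp.
{ intros a; clear; induction G as [|k l IH]; cbn; [ring|].
  unfold csum in IH; rewrite IH; ring. }
pose proof (Hf (fun k => Copp (c k))) as H2.
unfold character_term in H2; rewrite Eopp in H2.
fold (character_term d c x) in H2.
assert (Cmod (Cminus (Copp (csum G (character_term d c x))) p) <= r) as H3.
{ apply H2.
  - intros k Hk; rewrite c0 by easy; ring.
  - unfold wsum in *; eapply Rle_trans; [|exact Bc]; right; apply rsum_ext; intros; now rewrite Cmod_opp.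
  - intros i Hi; rewrite Eopp, Hker by easy; ring. }
set (v := csum G (character_term d c x)) in *.
assert (Cmod (Cmult (RtoC 2) v) <= 2 * r) as H4.
{ replace (Cmult (RtoC 2) v) with (Cplus (Cminus v p) (Copp (Cminus (Copp v) p)))
    by (apply injective_projections; cbn; ring).
  eapply Rle_trans; [apply Cmod_triangle|rewrite Cmod_opp; lra]. }
rewrite Cmod_mult, Cmod_R, Rabs_pos_eq in H4 by lra; lra.
Qed.

Lemma lam_std_fval x : in_cube d x -> lam_std d w (fun f => fval d f x).
Proof. intros Hx; exists x; split; [easy|intros f Hf; now apply (fval_spec d w Hw)]. Qed.

Lemma lam_std_all L : lam_std d w L -> lam_all d w L.
Proof.
intros [x [Hx HL]].
assert (forall f, inH d w f -> L f = fval d f x) as E.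
{ intros f Hf; symmetry; apply (fval_unique d w Hw); [easy|now apply HL]. }
split.
- intros f g a Hf Hg; rewrite !E by (try apply inH_lin; easy).
  now apply (fval_lin d w Hw).
- destruct (Hw d) as [_ [W HW]]; exists ((1 + W) / 2); intros f Hf Bf.
  rewrite E by easy; now apply (fval_bound d w Hw).
Qed.

Definition ball_data (N : nat) (Ls : nat -> Functional) (D : list C) (g : Coef) : Prop :=
  inH d w g /\ unit_ball d w g /\ map (fun i => Ls i g) (seq 0 N) = D.

(* Any interpolant from the unit ball is an optimal reconstruction up to a factor [2]. *)
Definition interpolate (N : nat) (Ls : nat -> Functional) (D : list C) : Output :=
  fval d (epsilon (inhabits (fun _ => RtoC 0)) (ball_data N Ls D)).

Lemma zero_unit_ball : unit_ball d w (fun _ => RtoC 0).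
Proof.
intros l _; unfold wsum; rewrite (rsum_ext l _ (fun _ => 0)) by (intros; rewrite Cmod_0; ring).
rewrite rsum_const; lra.
Qed.

(** The input and its interpolant share their data, so half their difference lies in the unit ball
    and vanishes at the nodes; undoing the halving costs the factor [2]. *)
Lemma interpolation_error N (X : nat -> nat -> R) B : (forall i, in_cube d (X i)) ->
  (forall u x, inH d w u -> unit_ball d w u -> (forall i, (i < N)%nat -> fval d u (X i) = RtoC 0) ->
     in_cube d x -> Cmod (fval d u x) <= B) ->
  exists r, alg_error d w N (fun i f => fval d f (X i))
     (interpolate N (fun i f => fval d f (X i))) = Finite r /\ r <= 2 * B.
Proof.
intros HX HB; set (Ls := fun i f => fval d f (X i)).
unfold alg_error.
match goal with |- context [Lub_Rbar ?e] => set (E := e) end.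
destruct (Lub_Rbar_correct E) as [Hub Hlub].
assert (Rbar_le (Lub_Rbar E) (Finite (2 * B))) as Hle.
{ apply Hlub; intros r [f [x [Hf [Bf [Hx ->]]]]]; cbn.
  set (D := map (fun i => Ls i f) (seq 0 N)).
  assert (ball_data N Ls D (epsilon (inhabits (fun _ => RtoC 0)) (ball_data N Ls D))) as Hg.
  { apply epsilon_spec; now exists f. }
  unfold interpolate; fold D; set (g := epsilon _ _) in *; destruct Hg as [Hg [Bg Dg]].
  assert (Cmod (fval d (half_diff f g) x) <= B) as Hh.
  { apply HB; [now apply inH_half_diff|now apply unit_ball_half_diff| |easy].
    intros i Hi; rewrite (fval_half_diff d w Hw) by easy.
    assert (fval d g (X i) = fval d f (X i)) as ->; [|ring].
    pose proof (f_equal (fun l => nth i l (RtoC 0)) Dg) as Hn; cbn in Hn; unfold D in Hn.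
    assert (forall h : Coef, nth i (map (fun i => Ls i h) (seq 0 N)) (RtoC 0) = Ls i h) as En.
    { intros h; rewrite nth_indep with (d' := Ls 0%nat h) by (rewrite length_map, length_seq; easy).
      rewrite (map_nth (fun i => Ls i h)), seq_nth by easy; easy. }
    now rewrite !En in Hn. }
  rewrite (fval_half_diff d w Hw), Cmod_mult, Cmod_R, Rabs_pos_eq in Hh by (easy || lra); lra. }
(* A nonnegative element excludes the value minus infinity, so the supremum is a real number, as
   [e_n] requires. *)
assert (exists r0, E r0 /\ 0 <= r0) as [r0 [Er0 H0]].
{ eexists; split;
  [exists (fun _ => RtoC 0), (fun _ => 0); split; [apply inH_zero|split; [apply zero_unit_ball|split]]|];
  [intros i _; lra|reflexivity|apply Cmod_ge_0]. }
specialize (Hub r0 Er0).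
destruct (Lub_Rbar E) as [r| |]; try easy; now exists r.
Qed.

End FiniteSupport.

(** * Comparison of the two information classes *)

(** Multiples of the first unit vector, which exists because [d >= 1]. *)
Lemma exists_frequencies d m : (1 <= d)%nat -> exists G, fin_index d G /\ length G = m.
Proof.
intros Hd; exists (map (fun j i => match i with O => Z.of_nat j | _ => 0%Z end) (seq 0 m)).
split; [split|now rewrite length_map, length_seq].
- apply FinFun.Injective_map_NoDup; [|apply seq_NoDup].
  intros a b E; apply Nat2Z.inj; exact (f_equal (fun k => k 0%nat) E).
- apply Forall_forall; intros k Hk; apply in_map_iff in Hk as [j [<- _]].
  intros [|i] Hi; [lia|easy].
Qed.

Lemma exists_positive_lower_bound {A} (l : list A) (a : A -> R) :
  (forall k, In k l -> 0 < a k) -> exists t, 0 < t /\ forall k, In k l -> t <= a k.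
Proof.
induction l as [|x l IH]; intros H; [exists 1; split; [lra|easy]|].
destruct IH as [t [Ht Hl]]; [intros; apply H; now right|].
exists (Rmin t (a x)); split; [apply Rmin_pos; [easy|apply H; now left]|].
intros k [<-|Hk]; [apply Rmin_r|eapply Rle_trans; [apply Rmin_l|auto]].
Qed.

Lemma rsum_seq_le_const N (a : nat -> R) eta : (forall i, (i < N)%nat -> a i <= eta) ->
  rsum (seq 0 N) a <= INR N * eta.
Proof.
intros H; apply Rle_trans with (rsum (seq 0 N) (fun _ => eta)).
- apply rsum_le; intros i Hi; apply H; apply in_seq in Hi; lia.
- rewrite rsum_const, length_seq; lra.
Qed.

(** The sum of all [l1] norms serves twice: it controls the Lipschitz constants, and it tells how
    fine the grid must be to avoid aliasing. *)
Lemma frequency_bound d (G : list Zvec) : fin_index d G -> exists B, 0 <= B /\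
  (forall k, In k G -> rsum (seq 0 d) (fun i => Rabs (IZR (k i))) <= B) /\
  (forall k i, In k G -> Rabs (IZR (k i)) <= B).
Proof.
intros FG; exists (rsum G (fun k => rsum (seq 0 d) (fun i => Rabs (IZR (k i))))).
assert (forall k : Zvec, 0 <= rsum (seq 0 d) (fun i => Rabs (IZR (k i)))) as P.
{ intros k; apply rsum_nonneg; intros; apply Rabs_pos. }
assert (0 <= rsum G (fun k => rsum (seq 0 d) (fun i => Rabs (IZR (k i))))) as PG
  by (apply rsum_nonneg; auto).
assert (forall k, In k G -> rsum (seq 0 d) (fun i => Rabs (IZR (k i))) <=
   rsum G (fun k => rsum (seq 0 d) (fun i => Rabs (IZR (k i))))) as HG.
{ intros k Hk; apply (rsum_In_le G (fun k : Zvec => rsum (seq 0 d) (fun i => Rabs (IZR (k i))))); auto. }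
split; [exact PG|split; [exact HG|]].
intros k i Hk; destruct (Nat.lt_ge_cases i d) as [Hi|Hi].
- eapply Rle_trans; [|exact (HG k Hk)].
  apply (rsum_In_le (seq 0 d) (fun i => Rabs (IZR (k i)))); [intros; apply Rabs_pos|].
  apply in_seq; lia.
- destruct FG as [_ F]; rewrite Forall_forall in F; rewrite (F k Hk i Hi), Rabs_R0; easy.
Qed.

Lemma trigpoly_lipschitz d G c x y B q : 0 <= q -> 0 <= B ->
  (forall k, In k G -> rsum (seq 0 d) (fun i => Rabs (IZR (k i))) <= B) ->
  (forall i, (i < d)%nat -> Rabs (x i - y i) <= q) ->
  Cmod (Cminus (trigpoly d G c x) (trigpoly d G c y)) <= 4 * PI * B * q * rsum G (fun k => Cmod (c k)).
Proof.
intros Hq HB HG Hxy; pose proof PI_RGT_0.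
assert (Cminus (trigpoly d G c x) (trigpoly d G c y) =
  csum G (fun k => Cplus (Cmult (Copp (RtoC 1)) (Cmult (c k) (cis2pi (dot d k y))))
                         (Cmult (c k) (cis2pi (dot d k x)))))
  as ->.
{ rewrite (csum_lin (A := Zvec)); unfold trigpoly; ring. }
eapply Rle_trans; [apply Cmod_csum|].
rewrite <- rsum_scal; apply rsum_le; intros k Hk.
replace (Cplus _ _) with (Cmult (c k) (Cminus (cis2pi (dot d k x)) (cis2pi (dot d k y))))
  by ring.
rewrite Cmod_mult, Rmult_comm; apply Rmult_le_compat_r; [apply Cmod_ge_0|].
eapply Rle_trans; [apply cis2pi_lipschitz|].
pose proof (dot_diff d k x y q Hxy) as Hd.
assert (Rabs (dot d k x - dot d k y) <= B * q).
{ eapply Rle_trans; [exact Hd|apply Rmult_le_compat_r; auto]. }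
replace (4 * PI * B * q) with (4 * PI * (B * q)) by ring.
apply Rmult_le_compat_l; lra.
Qed.

(* [20 T >= 2 (8 T + (2 + N) eta)]: the factor [2] is the price of interpolation, and
   [eta] bounds the errors of truncation and of rounding points to the grid. *)
Lemma sampling_comparison w d n : weight_ok w -> (1 <= d)%nat -> (1 <= n)%nat ->
  exists N T, (N <= 2 * n)%nat /\ 0 < T /\
    (forall Ls phi r, (forall i, (i < n)%nat -> lam_all d w (Ls i)) ->
       alg_error d w n Ls phi = Finite r -> T <= r) /\
    (exists Ls phi r, (forall i, (i < N)%nat -> lam_std d w (Ls i)) /\
       alg_error d w N Ls phi = Finite r /\ r <= 20 * T).
Proof.
intros Hw Hd Hn.
destruct (exists_frequencies d (S n) Hd) as [G0 [F0 L0]].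
destruct (exists_positive_lower_bound G0 (fun k => / w d k ^ 2)) as [t [Ht HtG0]].
{ intros k Hk; apply Rinv_0_lt_compat, pow_lt, (weight_pos d w Hw).
  exact (fin_index_supp d G0 k F0 Hk). }
(* Up to [2 n] samples, one truncation at [x] and one rounding each cost [eta], so together they
   cost at most [sqrt t <= T]. *)
set (eta := sqrt t / (2 * INR n + 2)).
assert (0 < 2 * INR n + 2) as Hn2 by (pose proof (pos_INR n); lra).
assert (0 < sqrt t) as Hst by now apply sqrt_lt_R0.
assert (0 < eta) as Heta by now apply Rdiv_lt_0_compat.
destruct (small_tail d w Hw G0 (eta ^ 2)) as [G [FG [IG HG]]]; [now apply pow_lt|easy|].
destruct (frequency_bound d G FG) as [B [B0 [HB HB']]].
destruct (Hw d) as [_ [W HW]].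
assert (0 <= W) as W0.
{ specialize (HW nil); cbn in HW; apply HW; split; [apply NoDup_nil|apply Forall_nil]. }
set (A := 4 * PI * B * ((1 + W) / 2)).
assert (0 <= A) as A0.
{ unfold A; pose proof PI_RGT_0; apply Rmult_le_pos; [apply Rmult_le_pos|]; lra. }
(* [Q > 2 B] excludes aliasing, and [Q > A / eta] keeps the rounding error below [eta]. *)
destruct (INR_unbounded (Rmax (2 * B) (A / eta))) as [Q HQ].
assert (2 * B < INR Q /\ A / eta < INR Q) as [HQB HQA].
{ split; eapply Rle_lt_trans; [|exact HQ| |exact HQ]; [apply Rmax_l|apply Rmax_r]. }
assert (0 < INR Q) as Q0 by lra.
assert (0 < Q)%nat as Q1 by (apply INR_lt; cbn; lra).
assert (forall k, In k G -> 0 < w d k) as wG.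
{ intros k Hk; apply (weight_pos d w Hw); exact (fin_index_supp d G k FG Hk). }
assert (forall (k l : Zvec) (i : nat), In k G -> In l G -> (Z.abs (k i - l i) < Z.of_nat Q)%Z) as GQ.
{ intros k l i Hk Hl; apply lt_IZR; rewrite abs_IZR, minus_IZR, <- INR_IZR_INZ.
  pose proof (HB' k i Hk); pose proof (HB' l i Hl).
  eapply Rle_lt_trans; [apply Rabs_triang|rewrite Rabs_Ropp; lra]. }
destruct (finite_comparison FG wG Q1 GQ Hn (proj1 F0) L0 IG HtG0)
  as [T [T0 [TtT [Hlow [N [X [HN [HX Hup]]]]]]]].
assert (sqrt t <= T) as HtT.
{ apply Rsqr_incr_0_var; [|easy]; rewrite Rsqr_sqrt by lra; unfold Rsqr; lra. }
exists N, T; split; [exact HN|split; [lra|split]].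
- intros Ls phi r HLs Hr.
  (* On coefficients supported in [G], a functional is determined by its values on the [delta k]. *)
  destruct (Hlow (fun i k => Ls i (delta k))) as [j [c [Hj [c0 [Hker [Hc HTc]]]]]].
  eapply Rle_trans; [exact HTc|].
  apply (alg_error_ge d w Hw n Ls phi r G c (gridpt Q j)); auto.
  now apply gridpt_in_cube.
- assert (forall a, in_cube d (gridpt Q (X a))) as HXc by (intros a; apply gridpt_in_cube, HX).
  destruct (interpolation_error d w Hw N (fun a => gridpt Q (X a)) (9 * T) HXc) as [r [Hr Hr2]].
  + intros u x Hu Bu HuX Hx.
    destruct (grid_approx d Q x Q1 Hx) as [j [Hj Hjx]].
    assert (forall y, Cmod (Cminus (fval d u y) (trigpoly d G u y)) <= eta) as Htr.
    { intros y; now apply (fval_truncation d w Hw G eta u y). }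
    assert (Cmod (Cminus (trigpoly d G u x) (trigpoly d G u (gridpt Q j))) <= eta) as Hgr.
    { eapply Rle_trans; [apply (trigpoly_lipschitz d G u _ _ B (/ INR Q)); auto|].
      - left; now apply Rinv_0_lt_compat.
      - apply Rle_trans with (A * / INR Q).
        + unfold A; pose proof PI_RGT_0.
          assert (0 < / INR Q) by now apply Rinv_0_lt_compat.
          assert (rsum G (fun k => Cmod (u k)) <= (1 + W) / 2).
          { pose proof (coef_sum_bound d w Hw u G 1 Rlt_0_1 FG); specialize (Bu G FG).
            specialize (HW G FG); lra. }
          replace (4 * PI * B * ((1 + W) / 2) * / INR Q) with
            (4 * PI * B * / INR Q * ((1 + W) / 2)) by ring.
          apply Rmult_le_compat_l; [|easy].
          apply Rmult_le_pos; [apply Rmult_le_pos|]; lra.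
        + apply Rmult_le_reg_r with (INR Q); [easy|]; rewrite Rmult_assoc, Rinv_l by lra.
          apply Rmult_le_reg_r with (/ eta); [now apply Rinv_0_lt_compat|].
          replace (eta * INR Q * / eta) with (INR Q) by (field; lra).
          unfold Rdiv in HQA; lra. }
    (* As [u] vanishes at the nodes, its truncation there equals the truncation error up to sign, so
       each sample is at most [eta]. *)
    assert (Cmod (trigpoly d G u (gridpt Q j)) <= 8 * T + INR N * eta) as Hgrid.
    { eapply Rle_trans; [now apply (Hup u j Hj), Bu|].
      apply Rplus_le_compat_l, rsum_seq_le_const; intros i Hi.
      replace (trigpoly d G u (gridpt Q (X i))) with
        (Copp (Cminus (fval d u (gridpt Q (X i))) (trigpoly d G u (gridpt Q (X i)))))
        by (rewrite HuX by easy; ring).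
      rewrite Cmod_opp; apply Htr. }
    specialize (Htr x).
    assert (Cmod (fval d u x) <= eta + (eta + (8 * T + INR N * eta))) as Hall.
    { replace (fval d u x) with (Cplus (Cminus (fval d u x) (trigpoly d G u x))
        (Cplus (Cminus (trigpoly d G u x) (trigpoly d G u (gridpt Q j)))
               (trigpoly d G u (gridpt Q j)))) by ring.
      eapply Rle_trans; [apply Cmod_triangle|apply Rplus_le_compat; [easy|]].
      eapply Rle_trans; [apply Cmod_triangle|apply Rplus_le_compat; easy]. }
    (* Hence the total is at most [8 T + sqrt t <= 9 T], the bound passed to
       [interpolation_error]. *)
    assert ((2 * INR n + 2) * eta = sqrt t) by (unfold eta; field; lra).
    apply le_INR in HN; rewrite mult_INR in HN; cbn [INR] in HN.
    assert (INR N * eta <= (2 * INR n) * eta) by (apply Rmult_le_compat_r; lra).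
    lra.
  + exists (fun i f => fval d f (gridpt Q (X i))),
      (interpolate d w N (fun i f => fval d f (gridpt Q (X i)))), r.
    split; [|split; [exact Hr|lra]].
    intros i _; apply (lam_std_fval d w Hw), HXc.
Qed.

(** * Information complexity and tractability exponents *)

Section InformationComplexity.
Variables (w : Weight) (crit : criterion).
Hypothesis Hw : weight_ok w.

Lemma Glb_Rbar_incl (E1 E2 : R -> Prop) : (forall r, E1 r -> E2 r) ->
  Rbar_le (Glb_Rbar E2) (Glb_Rbar E1).
Proof.
intros H; apply (proj2 (Glb_Rbar_correct E1)); intros r Hr.
apply (proj1 (Glb_Rbar_correct E2)); auto.
Qed.

Lemma e_n_all_le_std d n : Rbar_le (e_n lam_all d w n) (e_n lam_std d w n).
Proof.
apply Glb_Rbar_incl; intros r [Ls [phi [HL Hr]]]; exists Ls, phi; split; [|easy].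
intros i Hi; apply (lam_std_all d w Hw); auto.
Qed.

Lemma nstar_all_le_std eps d : Rbar_le (nstar lam_all crit w eps d) (nstar lam_std crit w eps d).
Proof.
apply Glb_Rbar_incl; intros r [n [-> Hn]]; exists n; split; [easy|].
eapply Rbar_le_trans; [apply e_n_all_le_std|exact Hn].
Qed.

(** The criterion is an extended real; nonnegativity leaves a finite value or plus infinity as the
    cases to scale by [eps]. *)
Lemma CRI_ge_0 d : Rbar_le (Finite 0) (CRI crit d w).
Proof.
destruct crit; cbn [CRI]; [cbn; lra|].
eapply Rbar_le_trans with (Finite (Cmod (fval d (fun _ => RtoC 0) (fun _ => 0)))).
- apply Cmod_ge_0.
- apply (proj1 (Lub_Rbar_correct _)).
  exists (fun _ => RtoC 0), (fun _ => 0); split; [apply inH_zero|split; [apply zero_unit_ball|split]];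
  [intros i _; lra|easy].
Qed.

(** Without functionals the class is irrelevant. This covers [n = 0], where [sampling_comparison]
    does not apply. *)
Lemma e_n_zero_info d : e_n lam_std d w 0 = e_n lam_all d w 0.
Proof.
unfold e_n; apply Glb_Rbar_eqset; intros r; split; intros [Ls [phi [_ Hr]]];
  exists Ls, phi; (split; [intros i Hi; lia|exact Hr]).
Qed.

(** The factor [20] lost in passing to samples is paid for by asking accuracy [eps / 20] of general
    information. *)
Lemma nstar_std_le eps d n : (1 <= d)%nat -> 0 < eps ->
  Rbar_le (e_n lam_all d w n) (Rbar_mult (Finite (eps / 20)) (CRI crit d w)) ->
  Rbar_le (nstar lam_std crit w eps d) (Finite (2 * INR n)).
Proof.
intros Hd He Hn.
assert (exists N, (N <= 2 * n)%nat /\ Rbar_le (e_n lam_std d w N) (Rbar_mult (Finite eps) (CRI crit d w)))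
  as [N [HN HeN]].
(* An infinite criterion is treated apart, since the arithmetic applies to finite values only. *)
{ assert (forall T, Rbar_le (Finite T) (Rbar_mult (Finite (eps / 20)) (CRI crit d w)) ->
    Rbar_le (Finite (20 * T)) (Rbar_mult (Finite eps) (CRI crit d w))) as Hscale.
  { intros T; pose proof (CRI_ge_0 d) as Hc; destruct (CRI crit d w) as [c| |]; try easy.
    - cbn; intros H; lra.
    - intros _; replace (Rbar_mult (Finite eps) p_infty) with p_infty; [easy|].
      symmetry; apply is_Rbar_mult_unique, is_Rbar_mult_sym, is_Rbar_mult_p_infty_pos; easy. }
  destruct n as [|n].
  - exists 0%nat; split; [lia|]; rewrite e_n_zero_info.
    eapply Rbar_le_trans; [exact Hn|].
    pose proof (CRI_ge_0 d) as Hc; destruct (CRI crit d w) as [c| |]; try easy.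
    + cbn in *; nra.
    + assert (forall a, 0 < a -> Rbar_mult (Finite a) p_infty = p_infty) as Hp.
      { intros a Ha; apply is_Rbar_mult_unique, is_Rbar_mult_sym, is_Rbar_mult_p_infty_pos; easy. }
      rewrite !Hp by lra; apply Rbar_le_refl.
  - destruct (sampling_comparison w d (S n) Hw Hd)
      as [N [T [HN [HT [Hlow [Ls [phi [r [HLs [Hr Hr2]]]]]]]]]]; [lia|].
    exists N; split; [easy|].
    apply Rbar_le_trans with (Finite r).
    { apply (proj1 (Glb_Rbar_correct _)); now exists Ls, phi. }
    apply Rbar_le_trans with (Finite (20 * T)); [exact Hr2|apply Hscale].
    eapply Rbar_le_trans; [|exact Hn].
    apply (proj2 (Glb_Rbar_correct _)); intros x [Ls' [phi' [HL' Hx]]].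
    now apply (Hlow Ls' phi'). }
apply Rbar_le_trans with (Finite (INR N)).
- apply (proj1 (Glb_Rbar_correct _)); now exists N.
- cbn; apply le_INR in HN; rewrite mult_INR in HN; cbn [INR] in HN; lra.
Qed.

(** [nstar] is an infimum, so an admissible [n] is extracted only below [B + 1]; this is the source
    of the added [1]. *)
Lemma nstar_std_le_all eps d B : (1 <= d)%nat -> 0 < eps ->
  Rbar_le (nstar lam_all crit w (eps / 20) d) (Finite B) ->
  Rbar_le (nstar lam_std crit w eps d) (Finite (2 * (B + 1))).
Proof.
intros Hd He HB.
assert (exists n, INR n < B + 1 /\
  Rbar_le (e_n lam_all d w n) (Rbar_mult (Finite (eps / 20)) (CRI crit d w))) as [n [Hn Hen]].
{ apply NNPP; intros no.
  assert (Rbar_le (Finite (B + 1)) (nstar lam_all crit w (eps / 20) d)) as H.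
  { apply (proj2 (Glb_Rbar_correct _)); intros r [n [-> Hn]]; cbn.
    apply Rnot_lt_le; intros Hlt; apply no; now exists n. }
  pose proof (Rbar_le_trans _ _ _ H HB) as H2; cbn in H2; lra. }
eapply Rbar_le_trans; [now apply (nstar_std_le eps d n)|cbn; lra].
Qed.

Lemma Rpower_eps_ge_1 eps p : 0 < eps < 1 -> 0 <= p -> 1 <= Rpower eps (- p).
Proof.
intros He Hp; unfold Rpower; rewrite <- exp_0.
assert (0 <= - p * ln eps) as [H|<-]; [|left; now apply exp_increasing|right; now rewrite exp_0].
assert (ln eps < 0) by (rewrite <- ln_1; apply ln_increasing; lra); nra.
Qed.

Lemma Rpower_INR_ge_1 d q : (1 <= d)%nat -> 0 <= q -> 1 <= Rpower (INR d) q.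
Proof.
intros Hd Hq; rewrite <- (Rpower_O (INR d)) by (apply lt_0_INR; lia).
apply le_INR in Hd; cbn in Hd; destruct Hd as [Hd|<-].
- destruct Hq as [Hq|<-]; [left; now apply Rpower_lt|right; reflexivity].
- unfold Rpower; rewrite ln_1, !Rmult_0_r; right; reflexivity.
Qed.

Lemma Rpower_scale eps p : 0 < eps -> Rpower (eps / 20) (- p) = Rpower 20 p * Rpower eps (- p).
Proof.
intros He; unfold Rdiv; rewrite <- Rpower_mult_distr by lra.
unfold Rpower at 2; rewrite ln_Rinv by lra.
replace (- p * - ln 20) with (p * ln 20) by ring; unfold Rpower; ring.
Qed.

(** Passing to [eps / 20] multiplies the bound by [20^p], and the added [1] is absorbed because
    [d^q eps^(-p) >= 1]. Only the constant changes, not [p] or [q]. *)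
Lemma ALG_PT_all_std : ALG_PT lam_all crit w -> ALG_PT lam_std crit w.
Proof.
intros [C0 [p [q [HC [Hp [Hq H]]]]]].
assert (0 < Rpower 20 p) by apply exp_pos.
exists (2 * (C0 * Rpower 20 p + 1)), p, q.
split; [nra|split; [easy|split; [easy|intros d eps Hd He]]].
assert (0 < eps / 20 < 1) as He2 by lra.
pose proof (nstar_std_le_all eps d _ Hd (proj1 He) (H d (eps / 20) Hd He2)) as Hn.
eapply Rbar_le_trans; [exact Hn|cbn].
rewrite Rpower_scale by easy.
pose proof (Rpower_eps_ge_1 eps p He Hp); pose proof (Rpower_INR_ge_1 d q Hd Hq).
assert (1 <= Rpower (INR d) q * Rpower eps (- p)) by nra.
lra.
Qed.

Lemma ALG_SPT_with_all_std p : 0 <= p -> ALG_SPT_with lam_all crit w p -> ALG_SPT_with lam_std crit w p.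
Proof.
intros Hp [C0 [HC H]].
assert (0 < Rpower 20 p) by apply exp_pos.
exists (2 * (C0 * Rpower 20 p + 1)); split; [nra|intros d eps Hd He].
assert (0 < eps / 20 < 1) as He2 by lra.
pose proof (nstar_std_le_all eps d _ Hd (proj1 He) (H d (eps / 20) Hd He2)) as Hn.
eapply Rbar_le_trans; [exact Hn|cbn].
rewrite Rpower_scale by easy.
pose proof (Rpower_eps_ge_1 eps p He Hp).
lra.
Qed.

Lemma ALG_SPT_with_std_all p : ALG_SPT_with lam_std crit w p -> ALG_SPT_with lam_all crit w p.
Proof.
intros [C0 [HC H]]; exists C0; split; [easy|intros d eps Hd He].
eapply Rbar_le_trans; [apply nstar_all_le_std|now apply H].
Qed.

Lemma ALG_PT_std_all : ALG_PT lam_std crit w -> ALG_PT lam_all crit w.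
Proof.
intros [C0 [p [q [HC [Hp [Hq H]]]]]]; exists C0, p, q.
split; [easy|split; [easy|split; [easy|intros d eps Hd He]]].
eapply Rbar_le_trans; [apply nstar_all_le_std|now apply H].
Qed.

End InformationComplexity.

Theorem theorem4p1 (w : Weight) (crit : criterion) (Hw : weight_ok w) :
  (ALG_PT lam_all crit w <-> ALG_PT lam_std crit w) /\
  (ALG_SPT lam_all crit w <-> ALG_SPT lam_std crit w) /\
  (ALG_SPT lam_all crit w -> ALG_pstar lam_all crit w = ALG_pstar lam_std crit w).
Proof.
(* Both classes admit exactly the same exponents, which settles strong tractability and the equality
   of the infima together. *)
assert (forall p, 0 <= p /\ ALG_SPT_with lam_all crit w p <-> 0 <= p /\ ALG_SPT_with lam_std crit w p)
  as Hp.
{ intros p; split; intros [H0 H]; (split; [exact H0|]).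
  - now apply ALG_SPT_with_all_std.
  - now apply ALG_SPT_with_std_all. }
split; [split; [now apply ALG_PT_all_std|now apply ALG_PT_std_all]|split].
- split; intros [p H]; exists p; now apply Hp.
- intros _; now apply Glb_Rbar_eqset.
Qed.
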